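(* Let $(\Omega,T,\mu)$ be an ergodic topological dynamical system such that $\Omega=\operatorname{supp}\mu$. There is a countable group $\mathfrak{A}=\mathfrak{A}(\Omega,T,\mu)\subseteq\mathbb{R}$, namely the Schwartzman group of $(\Omega,T,\mu)$ (which depends only on $(\Omega,T,\mu)$), such that the following holds. For every continuous $g:\Omega\to(0,\infty)$, with associated Ising partition functions $$\mathcal{Z}_N(\zeta,\omega)=\sum_{\sigma\in\{\pm1\}^N}\ \prod_{n=1}^N e^{g(T^n\omega)\sigma_n\sigma_{n+1}}\,\zeta^{\sigma_n}\qquad(\sigma_{N+1}:=\sigma_1),$$ if $\zeta_1,\zeta_2\in\partial\mathbb{D}$ each lie in a spectral gap of the associated Ising model, then for $\mu$-a.e. $\omega\in\Omega$ the limit $$\lim_{N\to\infty}\frac1N\,\#\{\zeta\in[\zeta_1,\zeta_2]:\mathcal{Z}_N(\zeta,\omega)=0\}$$ exists and belongs to $\mathfrak{A}(\Omega,T,\mu)$. Here $[\zeta_1,\zeta_2]$ denotes the closed arc of $\partial\mathbb{D}$ from $\zeta_1$ to $\zeta_2$ in the counterclockwise direction.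
   Context: $\partial\mathbb{D}=\{\zeta\in\mathbb{C}:|\zeta|=1\}$, $\mathbb{T}=\mathbb{R}/\mathbb{Z}$. An ergodic topological dynamical system $(\Omega,T,\mu)$ consists of a compact metric space $\Omega$, a homeomorphism $T:\Omega\to\Omega$, and a $T$-invariant Borel probability measure $\mu$ that is ergodic with respect to $T$. Spectral gap: $\zeta_0\in\partial\mathbb{D}$ is in a spectral gap of the Ising model (determined by $g$) if there is $\varepsilon>0$ such that for $\mu$-a.e. $\omega$ and all sufficiently large $N$, the function $\mathcal{Z}_N(\cdot,\omega)$ has no zeros in the $\varepsilon$-neighborhood of $\zeta_0$. Schwartzman group: the suspension $(X,\tau,\nu)$ of $(\Omega,T,\mu)$ is defined by $X=(\Omega\times\mathbb{R})/\sim$, where $(\omega,t)\sim(\omega',t')$ iff $t-t'\in\mathbb{Z}$ and $T^{t-t'}\omega=\omega'$; the flow is $\tau^s([\omega,t])=[\omega,t+s]$; and $\int_X f\,d\nu=\int_\Omega\int_0^1 f([\omega,t])\,dt\,d\mu(\omega)$. For a continuous $\phi:X\to\mathbb{T}$ and $x\in X$, let $\psi_x:\mathbb{R}\to\mathbb{R}$ be a continuous lift of $t\mapsto\phi(\tau^t x)$. By a theorem of Schwartzman there is a real number $\mathrm{rot}(\phi)$ with $\mathrm{rot}(\phi)=\lim_{t\to\infty}\psi_x(t)/t$ for $\nu$-a.e. $x$, and it depends only on the homotopy class of $\phi$. The Schwartzman group is $\mathfrak{A}(\Omega,T,\mu)=\{\mathrm{rot}(\phi):\phi\in C(X,\mathbb{T})\}\subseteq\mathbb{R}$.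 *)

(* Defs.v *)
From HB Require Import structures.
From mathcomp Require Import all_boot all_order all_algebra.
From mathcomp Require Import all_classical all_reals all_analysis.
From mathcomp Require Import finmap complex.

Set Implicit Arguments.
Unset Strict Implicit.
Unset Printing Implicit Defensive.

Import Order.TTheory GRing.Theory Num.Theory.
Import numFieldNormedType.Exports.

Local Open Scope classical_set_scope.
Local Open Scope quotient_scope.
Local Open Scope ring_scope.

(* Measurable types are pointed in MathComp-Analysis while metric spaces need
   not be; pointedness only excludes the empty space, which carries no
   probability measure. *)
#[short(type="pmetricType")]
HB.structure Definition PointedMetric (R : numDomainType) :=
  {M of Pointed M & Metric R M}.

Notation borel X := (g_sigma_algebraType (@open X)).

Record homeo (X : topologicalType) := Homeo {
  homeo_fun :> X -> X;
  homeo_inv : X -> X;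
  homeoK : cancel homeo_fun homeo_inv;
  homeo_invK : cancel homeo_inv homeo_fun;
  homeo_continuous : continuous homeo_fun;
  homeo_inv_continuous : continuous homeo_inv
}.

Definition homeo_iter (X : topologicalType) (T : homeo X) (k : int) : X -> X :=
  match k with
  | Posz n => iter n T
  | Negz n => iter n.+1 (homeo_inv T)
  end.

Section dynamics.
Variables (R : realType) (Omega : pmetricType R) (T : homeo Omega).
Variable mu : probability (borel Omega) R.

Definition invariant_measure : Prop :=
  forall A : set (borel Omega), measurable A -> mu (T @^-1` A) = mu A.

Definition ergodic : Prop :=
  forall A : set (borel Omega), measurable A -> T @^-1` A = A ->
    mu A = 0%E \/ mu A = 1%E.

Definition measure_support : set Omega :=
  [set w | forall U : set Omega, open U -> U w -> (0 < mu U)%E].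

End dynamics.

Section circle.
Variable R : realType.

Definition circle_rel : rel R := fun x y => x - y \is a Num.int.

Lemma circle_rel_refl : reflexive circle_rel.
Proof. by move=> x; rewrite /circle_rel subrr rpred0. Qed.

Lemma circle_rel_sym : symmetric circle_rel.
Proof. by move=> x y; rewrite /circle_rel -opprB rpredN. Qed.

Lemma circle_rel_trans : transitive circle_rel.
Proof.
move=> y x z; rewrite /circle_rel => xy yz.
by rewrite -(subrKA y); exact: rpredD.
Qed.

Definition circle_equiv :=
  EquivRel circle_rel circle_rel_refl circle_rel_sym circle_rel_trans.

Definition circle := quotient_topology {eq_quot circle_equiv}.
HB.instance Definition _ := Topological.on circle.
HB.instance Definition _ := Quotient.on circle.

End circle.

Section suspension.
Variables (R : realType) (Omega : pmetricType R) (T : homeo Omega).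

Lemma homeo_iterS k w : homeo_iter T (k + 1) w = T (homeo_iter T k w).
Proof.
case: k => [n|[|n]].
- by rewrite -[Posz n + 1]/(Posz (n + 1)) addn1.
- by rewrite /= homeo_invK.
- have -> : Negz n.+1 + 1 = Negz n.
    by rewrite !NegzE (intS n.+1) opprD addrAC addNr add0r.
  by rewrite /= homeo_invK.
Qed.

Lemma homeo_iterB k w : homeo_iter T (k - 1) w = homeo_inv T (homeo_iter T k w).
Proof. by rewrite -[k in RHS](subrK 1) homeo_iterS homeoK. Qed.

Lemma homeo_iterD j k w :
  homeo_iter T (j + k) w = homeo_iter T j (homeo_iter T k w).
Proof.
elim/int_rect: j => [|n IH|n IH]; first by rewrite add0r.
- by rewrite intS [1 + _]addrC addrAC !homeo_iterS IH.
- by rewrite intS opprD [- 1 + _]addrC addrAC !homeo_iterB IH.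
Qed.

Definition suspension_rel : rel (Omega * R) := fun p q =>
  `[< exists2 k : int, p.2 - q.2 = k%:~R & homeo_iter T k p.1 = q.1 >].

Lemma suspension_rel_refl : reflexive suspension_rel.
Proof. by move=> p; apply/asboolP; exists 0; rewrite ?subrr. Qed.

Lemma suspension_rel_sym : symmetric suspension_rel.
Proof.
suff H p q : suspension_rel p q -> suspension_rel q p.
  by move=> p q; apply/idP/idP; exact: H.
move=> /asboolP[k pq Tk]; apply/asboolP; exists (- k).
  by rewrite -opprB pq rmorphN.
by rewrite -Tk -homeo_iterD addNr.
Qed.

Lemma suspension_rel_trans : transitive suspension_rel.
Proof.
move=> q p r /asboolP[j pq Tj] /asboolP[k qr Tk]; apply/asboolP.
exists (k + j); first by rewrite -(subrKA q.2) pq qr rmorphD addrC.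
by rewrite homeo_iterD Tj.
Qed.

Definition suspension_equiv :=
  EquivRel suspension_rel suspension_rel_refl suspension_rel_sym
    suspension_rel_trans.

Definition suspension := quotient_topology {eq_quot suspension_equiv}.
HB.instance Definition _ := Topological.on suspension.
HB.instance Definition _ := Quotient.on suspension.
HB.instance Definition _ :=
  isPointed.Build suspension (\pi_suspension (point, 0)).

Definition suspension_flow (s : R) (x : suspension) : suspension :=
  \pi_suspension ((repr x).1, (repr x).2 + s).

Lemma suspension_flowE s w t :
  suspension_flow s (\pi_suspension (w, t)) = \pi_suspension (w, t + s).
Proof.
apply/eqP; rewrite /suspension_flow.
have /eqmodP/asboolP[k kE Tk] :
    repr (\pi_suspension (w, t)) = (w, t) %[mod {eq_quot suspension_equiv}].
  by rewrite reprK.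
apply/eqP/eqmodP/asboolP; exists k => //=.
by rewrite opprD addrACA subrr addr0.
Qed.

Variable mu : probability (borel Omega) R.

(* The functional f |-> \int_Omega \int_0^1 f [w, t] dt dmu(w), evaluated at the
   indicator functions of Borel sets. *)
Definition suspension_measure (A : set (borel suspension)) : \bar R :=
  \int[mu]_w \int[@lebesgue_measure R]_(t in `[0%R, 1%R])
    (\1_A (\pi_suspension (w, t)))%:E.

(* Continuous lifts along an orbit exist and differ by an integer constant, so
   the limit below does not depend on the lift. *)
Definition is_lift (phi : suspension -> circle R) (x : suspension)
    (psi : R -> R) : Prop :=
  continuous psi /\ forall t, \pi_(circle R) (psi t) = phi (suspension_flow t x).

Definition is_rot (phi : suspension -> circle R) (r : R) : Prop :=
  {ae suspension_measure, forall x, exists2 psi : R -> R,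
    is_lift phi x psi & psi t / t @[t --> +oo] --> r}.

Definition schwartzman : set R :=
  [set r | exists2 phi : suspension -> circle R, continuous phi & is_rot phi r].

End suspension.

Section ising.
Local Open Scope complex_scope.
Variables (R : realType) (Omega : pmetricType R) (T : homeo Omega).
Variables (mu : probability (borel Omega) R) (g : Omega -> R).

Definition spin (b : bool) : int := (-1) ^+ b.

(* The site n in {1, ..., N} is the index n - 1 of 'I_N, and ordS is the
   cyclic successor. *)
Definition partition_function (N : nat) (z : R[i]) (w : Omega) : R[i] :=
  \sum_(s : {ffun 'I_N -> bool}) \prod_(i < N)
    ((expR (g (iter i.+1 T w) * (spin (s i) * spin (s (ordS i)))%:~R))%:C
     * z ^ spin (s i)).

(* Since 0^-1 = 0, the origin must be excluded from the zeros. *)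
Definition partition_zeros (N : nat) (w : Omega) : set R[i] :=
  [set z | z != 0 /\ partition_function N z w = 0].

Definition in_spectral_gap (z0 : R[i]) : Prop :=
  exists2 eps : R, 0 < eps &
    {ae mu, forall w, \forall N \near \oo,
      forall z : R[i], `|z - z0| < eps%:C -> ~ partition_zeros N w z}.

Definition cis (t : R) : R[i] := cos t +i* sin t.

(* The degenerate arc from a point to itself is that point. *)
Definition circle_arc (z1 z2 : R[i]) : set R[i] :=
  [set z | exists a s t : R, [/\ 0 <= s <= t, t < 2 * pi,
    z1 = cis a, z = cis (a + s) & z2 = cis (a + t)]].

(* For 0 < N, z ^+ N * partition_function N z w is a polynomial in z with
   positive leading coefficient, so its zero set is finite and fset_set does not
   take its default value; zeros are counted without multiplicity. *)
Definition zero_count (z1 z2 : R[i]) (w : Omega) (N : nat) : nat :=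
  #|` fset_set (circle_arc z1 z2 `&` partition_zeros N w)|.

End ising.

(* Main.v *)
(* At zeta = e^(i th) the partition function is the trace of a product of real
   matrices, each a diagonal matrix diag(2 cosh g, 2 sinh g) followed by the
   rotation by th. Since g > 0 these matrices act monotonically on lines, hence
   on angles modulo pi, and the lifted orbit of an angle increases with th. A
   zero of the trace means that the N-step map sends every line to a second one
   and back, which happens once between two consecutive crossings of a multiple
   of pi; so the zeros on an arc are counted, up to a bounded error, by the
   difference of the rotations at its end points, divided by pi.

   In a gap at th0 no zero lies between th0 - d and th0 + d, so the two orbits
   driven by th0 - d and th0 + d almost surely stay within 2 pi of each other.
   By recurrence and the full support of mu, every point of Omega then has a
   confined angle, for which they stay within pi of each other. Near a confined
   angle the dynamics contracts angles at a summable rate, so two angles with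
   confined backward orbits, which would separate in backward time, agree modulo
   pi, and compactness provides one such angle over every point. This is a continuous invariant section of lines, and its
   increment is a continuous cocycle c with values congruent to a coboundary
   modulo 1: Birkhoff's theorem identifies its mean both with the rotation
   number at th0 and with the rotation number of a map from the suspension to
   the circle. Countability holds because a map to the circle is determined up
   to homotopy by finitely many rational data. *)
Require Import Defs.
From HB Require Import structures.
From mathcomp Require Import all_boot all_order all_algebra.
From mathcomp Require Import all_classical all_reals all_analysis.
From mathcomp Require Import finmap complex zify ring lra measurable_realfun.

Set Implicit Arguments.
Unset Strict Implicit.
Unset Printing Implicit Defensive.

Import Order.TTheory GRing.Theory Num.Theory.
Import numFieldNormedType.Exports.

Local Open Scope classical_set_scope.
Local Open Scope quotient_scope.
Local Open Scope ring_scope.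

(** * Projective action of a diagonal matrix on angles *)

Section half_turn_angles.
Variable R : realType.
Implicit Types x y g : R.

Lemma sinDpi_int x (k : int) : sin (x + pi * k%:~R) = (-1) ^ k * sin x.
Proof.
elim/int_rect: k => [|n IH|n IH]; first by rewrite mulr0 addr0 expr0z mul1r.
- rewrite intS rmorphD/= mulrDr mulr1 addrCA addrC sinDpi IH exprzDr ?unitrN1//.
  by rewrite expr1z mulN1r mulNr.
- rewrite intS opprD rmorphD/= mulrDr mulrN1 addrCA addrC.
  have := sinDpi (x + pi * (- n%:Z)%:~R - pi); rewrite subrK => /eqP.
  rewrite -eqr_oppLR => /eqP <-; rewrite IH exprzDr ?unitrN1//.
  by rewrite -[(-1) ^ (-1)]/((-1)^-1) invrN1 mulN1r mulNr.
Qed.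

Lemma cosDpi_int x (k : int) : cos (x + pi * k%:~R) = (-1) ^ k * cos x.
Proof.
by rewrite -!sinDpihalf addrAC sinDpi_int.
Qed.

Lemma sin_lt0_pi x : - pi < x < 0 -> sin x < 0.
Proof.
move=> /andP[x1 x2]; rewrite -oppr_gt0 -sinN sin_gt0_pi//.
by rewrite oppr_gt0 x2/= ltrNl.
Qed.

Lemma sin_eq0_pi x : - pi < x < pi -> sin x = 0 -> x = 0.
Proof.
move=> /andP[x1 x2] s0; apply/eqP; case: (ltgtP x 0) => // x0.
- by have := @sin_lt0_pi x; rewrite s0 x1 x0 ltxx => /(_ isT).
- by have := @sin_gt0_pi _ x; rewrite s0 x2 x0 ltxx => /(_ isT).
Qed.

Lemma sin_eq0_int x : sin x = 0 -> exists k : int, x = pi * k%:~R.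
Proof.
move=> s0; have p0 := @pi_gt0 R.
pose k := Num.floor (x / pi); exists k.
have := floor_itv (x / pi).
rewrite -/k => /andP[k1 k2].
apply/eqP; rewrite -subr_eq0; apply/eqP/sin_eq0_pi; last first.
  by rewrite -mulrN -rmorphN sinDpi_int s0 mulr0.
move: k1 k2; rewrite ler_pdivlMr// ltr_pdivrMr// rmorphD/= => k1 k2.
apply/andP; split; nra.
Qed.

(* [diag(e^g + e^-g, e^g - e^-g)] maps the unit vector of angle [x] to the vector
   of polar coordinates [(hradius g x, hangle g x)]; the choice of [atan] makes
   [hangle g] commute with translations by [pi]. *)
Definition hangle g x := x - atan (sin (2 * x) / (expR (2 * g) + cos (2 * x))).

Definition hradius g x := expR (- g) * (expR (2 * g) + cos (2 * x)) /
  cos (atan (sin (2 * x) / (expR (2 * g) + cos (2 * x)))).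

(** The determinant of the diagonal matrix, equal to [2 sinh (2 g)]. *)
Definition hdet g := (expR g + expR (- g)) * (expR g - expR (- g)).

Lemma hdenom_gt0 g x : 0 < g -> 0 < expR (2 * g) + cos (2 * x).
Proof.
move=> g0; have := cos_geN1 (2 * x); have : 1 < expR (2 * g).
  by rewrite expR_gt1 mulr_gt0.
by lra.
Qed.

Lemma cos_atan_gt0 x : 0 < cos (atan x).
Proof. by apply: cos_gt0_pihalf; rewrite atan_gtNpi2 atan_ltpi2. Qed.

Lemma sin_atan x : sin (atan x) = x * cos (atan x).
Proof.
rewrite -{2}[x]atanK /tan -mulrA mulVf ?mulr1//.
by rewrite gt_eqF// cos_atan_gt0.
Qed.

Lemma hradius_gt0 g x : 0 < g -> 0 < hradius g x.
Proof.
by move=> g0; rewrite /hradius !mulr_gt0 ?expR_gt0 ?hdenom_gt0 ?invr_gt0 ?cos_atan_gt0.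
Qed.

Lemma hdet_gt0 g : 0 < g -> 0 < hdet g.
Proof.
move=> g0; apply: mulr_gt0; first by rewrite addr_gt0 ?expR_gt0.
by rewrite subr_gt0 ltr_expR; lra.
Qed.

Lemma hangle_polar g x : 0 < g ->
  hradius g x * cos (hangle g x) = (expR g + expR (- g)) * cos x /\
  hradius g x * sin (hangle g x) = (expR g - expR (- g)) * sin x.
Proof.
move=> g0; rewrite /hradius /hangle cosB sinB.
have X0 := hdenom_gt0 x g0; set X := _ + _ in X0 *.
set a := atan _; have c0 : 0 < cos a by exact: cos_atan_gt0.
have sa : sin a = sin (2 * x) / X * cos a by exact: sin_atan.
rewrite sa.
have -> : expR (- g) * X / cos a * (cos x * cos a + sin x * (sin (2 * x) / X * cos a))
  = expR (- g) * (X * cos x + sin x * sin (2 * x)).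
  by field; rewrite !gt_eqF.
have -> : expR (- g) * X / cos a * (sin x * cos a - cos x * (sin (2 * x) / X * cos a))
  = expR (- g) * (X * sin x - cos x * sin (2 * x)).
  by field; rewrite !gt_eqF.
rewrite /X expRM_natl mulr_natl cos_mulr2n sin_mulr2n expRN.
have s2 := sin2cos2 x; have e0 : expR g != 0 by rewrite gt_eqF ?expR_gt0.
split.
- transitivity ((expR g ^+ 2 * cos x + cos x * ((cos x ^+ 2) *+2 - 1 + 2 * sin x ^+2)) / expR g); first by field.
  by rewrite s2; field.
- transitivity ((expR g ^+ 2 * sin x + sin x * (- 1)) / expR g); by field.
Qed.

(** The sine of an angle difference times both lengths is the cross product of the vectors, and a
    linear map multiplies cross products by its determinant. *)
Lemma sin_hangleB g x y : 0 < g ->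
  sin (hangle g y - hangle g x) * (hradius g x * hradius g y) =
  hdet g * sin (y - x).
Proof.
move=> g0; have [cx sx] := hangle_polar x g0; have [cy sy] := hangle_polar y g0.
transitivity (hradius g y * sin (hangle g y) * (hradius g x * cos (hangle g x)) -
  hradius g y * cos (hangle g y) * (hradius g x * sin (hangle g x))).
  by rewrite sinB; ring.
by rewrite cx sx cy sy sinB /hdet; ring.
Qed.

Lemma hangleDpi g x : hangle g (x + pi) = hangle g x + pi.
Proof.
rewrite /hangle mulrDr [2 * pi]mulr_natl sinD2pi cosD2pi addrAC.
by [].
Qed.

Lemma hangle_near g x : `|hangle g x - x| < pi / 2.
Proof. by rewrite /hangle addrAC subrr add0r normrN ltr_norml atan_gtNpi2 atan_ltpi2. Qed.

Lemma hangleB_pi g x y : 0 < g -> x < y < x + pi ->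
  hangle g x < hangle g y < hangle g x + pi.
Proof.
move=> g0 /andP[xy yx].
have s0 : 0 < sin (hangle g y - hangle g x).
  rewrite -(pmulr_lgt0 _ (mulr_gt0 (hradius_gt0 x g0) (hradius_gt0 y g0))).
  by rewrite sin_hangleB// mulr_gt0 ?hdet_gt0// sin_gt0_pi// subr_gt0 xy ltrBlDl.
(* Each angle moves by less than [pi / 2], so the difference lies in [(- pi, 2 pi)], where a
   positive sine forces it into [(0, pi)]. *)
have := hangle_near g x; have := hangle_near g y; rewrite !ltr_norml => /andP[y1 y2] /andP[x1 x2].
have l1 : - pi < hangle g y - hangle g x by lra.
have l2 : hangle g y - hangle g x < pi *+ 2 by lra.
have h0 : 0 < hangle g y - hangle g x.
  rewrite ltNge le_eqVlt; apply/negP => /orP[/eqP e|e].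
    by rewrite e sin0 ltxx in s0.
  by have := @sin_lt0_pi (hangle g y - hangle g x); rewrite l1 e => /(_ isT); rewrite ltNge (ltW s0).
have h1 : hangle g y - hangle g x < pi.
  rewrite ltNge le_eqVlt; apply/negP => /orP[/eqP e|e].
    by rewrite -e sinpi ltxx in s0.
  have := @sin_gt0_pi _ (hangle g y - hangle g x - pi).
  rewrite subr_gt0 e ltrBlDr -mulr2n l2 => /(_ isT).
  have := sinDpi (hangle g y - hangle g x - pi); rewrite subrK => e2.
  by move: s0; rewrite e2; lra.
by lra.
Qed.

Lemma hangleDpi_int g x (k : int) : hangle g (x + pi * k%:~R) = hangle g x + pi * k%:~R.
Proof.
elim/int_rect: k => [|n IH|n IH]; first by rewrite mulr0 !addr0.
- by rewrite intS rmorphD/= mulrDr mulr1 addrCA addrC hangleDpi IH; ring.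
- have := hangleDpi g (x + pi * (- n.+1%:Z)%:~R).
  have -> : x + pi * (- n.+1%:Z)%:~R + pi = x + pi * (- n%:Z)%:~R.
    by rewrite !rmorphN/= -!pmulrn mulrSr; ring.
  rewrite IH => /eqP; rewrite eq_sym -subr_eq => /eqP <-.
  by rewrite !rmorphN/= -!pmulrn mulrSr; ring.
Qed.

(** Gaps below [pi] are covered by [hangleB_pi]; larger ones reduce to them by multiples of [pi],
    with which [hangle g] commutes. *)
Lemma hangle_mono g : 0 < g -> {mono hangle g : x y / x < y}.
Proof.
move=> g0; have incr : {homo hangle g : x y / x < y}.
  move=> x y xy; have p0 := @pi_gt0 R.
  pose k := Num.floor ((y - x) / pi).
  have := floor_itv ((y - x) / pi).
  rewrite -/k ler_pdivlMr// ltr_pdivrMr// rmorphD/= => /andP[k1 k2].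
  have k0 : (0 : R) <= k%:~R.
    by rewrite ler0z floor_ge0 divr_ge0 ?(ltW p0)// subr_ge0 ltW.
  pose z := y - pi * k%:~R.
  have -> : y = z + pi * k%:~R by rewrite subrK.
  rewrite hangleDpi_int.
  have [zx|zx] := eqVneq z x.
    rewrite zx ltrDl mulr_gt0// lt_neqAle k0 andbT eq_sym.
    by apply/eqP => k00; move: zx xy; rewrite /z k00 mulr0 subr0 => ->; rewrite ltxx.
  have := @hangleB_pi g x z g0.
  have -> : x < z < x + pi.
    rewrite lt_neqAle eq_sym zx/=; apply/andP; split; rewrite /z; nra.
  by move=> /(_ isT)/andP[l _]; rewrite (lt_le_trans l)// lerDl mulr_ge0 ?(ltW p0).
move=> x y; case: (ltgtP x y) => [/incr//|/incr/ltW|->]; last by rewrite ltxx.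
by rewrite leNgt => /negbTE.
Qed.

Lemma hangle_mono_le g : 0 < g -> {mono hangle g : x y / x <= y}.
Proof. by move=> g0 x y; rewrite !leNgt hangle_mono. Qed.

(** Conjugating by a quarter turn exchanges the two diagonal entries, which inverts the matrix up to
    a positive scalar. *)
Definition hangle_inv g x := hangle g (x - pi / 2) + pi / 2.

Lemma hangle_invK g : 0 < g -> cancel (hangle_inv g) (hangle g).
Proof.
move=> g0 x; rewrite /hangle_inv; set z := hangle g (x - pi / 2).
(* Two displacements below a quarter turn leave an error in [(- pi, pi)], so it suffices that its
   sine vanishes. *)
apply/eqP; rewrite -subr_eq0; apply/eqP/sin_eq0_pi.
  have := hangle_near g (z + pi / 2); have := hangle_near g (x - pi / 2).
  rewrite -/z !ltr_norml; lra.
have r1 := hradius_gt0 (x - pi / 2) g0; have r2 := hradius_gt0 (z + pi / 2) g0.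
have [c1 s1] := hangle_polar (x - pi / 2) g0.
have [c2 s2] := hangle_polar (z + pi / 2) g0.
rewrite -/z cosBpihalf sinBpihalf in c1 s1.
rewrite cosDpihalf sinDpihalf in c2 s2.
apply: (mulfI (lt0r_neq0 r1)); apply: (mulfI (lt0r_neq0 r2)).
rewrite !mulr0 sinB.
transitivity (hradius g (x - pi / 2) * (hradius g (z + pi / 2) * sin (hangle g (z + pi / 2))) * cos x -
  hradius g (x - pi / 2) * (hradius g (z + pi / 2) * cos (hangle g (z + pi / 2))) * sin x); first by ring.
rewrite c2 s2.
transitivity ((expR g - expR (- g)) * cos x * (hradius g (x - pi / 2) * cos z) +
  (expR g + expR (- g)) * sin x * (hradius g (x - pi / 2) * sin z)); first by ring.
rewrite c1 s1; ring.
Qed.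

Lemma hangleK g : 0 < g -> cancel (hangle g) (hangle_inv g).
Proof.
move=> g0 x; have h := hangle_invK g0 (hangle g x).
by apply/le_anti; rewrite -(hangle_mono_le g0) h lexx -(hangle_mono_le g0) h lexx.
Qed.

Lemma hangle_continuous (X : topologicalType) (a b : X -> R) (t : X) :
  (forall u, 0 < a u) -> {for t, continuous a} -> {for t, continuous b} ->
  {for t, continuous (fun u => hangle (a u) (b u))}.
Proof.
move=> a0 ca cb; apply: cvgB => //.
have c2 (c : X -> R) : {for t, continuous c} -> {for t, continuous (fun u => 2 * c u)}.
  by move=> cc; apply: cvgM => //; exact: cvg_cst.
apply: continuous_cvg; first exact: continuous_atan.
apply: cvgM.
  by apply: continuous_cvg; [exact: continuous_sin|exact: c2].
apply: cvgV; first by rewrite gt_eqF// hdenom_gt0.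
apply: cvgD; apply: continuous_cvg; (try exact: c2); first exact: continuous_expR.
exact: continuous_cos.
Qed.

End half_turn_angles.

Lemma continuous_at_comp (X Y Z : topologicalType) (f : X -> Y) (h : Y -> Z) t :
  continuous h -> {for t, continuous f} -> {for t, continuous (fun u => h (f u))}.
Proof. by move=> ch cf; exact: (continuous_cvg _ (ch _) cf). Qed.

(** * Lifted orbits of angles, transfer matrices, and zeros of the trace *)

Section transfer.
Variables (R : realType) (Omega : topologicalType) (T : Omega -> Omega).
Variable g : Omega -> R.
Hypothesis g_gt0 : forall w, 0 < g w.
Implicit Types (th x y : R) (w : Omega) (n : nat).

(** Angles are followed on the real line, so that half turns are counted. The first step uses
    [g (T w)], the weight of site [1]. *)
Fixpoint lift_orbit th n w x : R :=
  if n is m.+1 then hangle (g (iter m.+1 T w)) (lift_orbit th m w x) + th else x.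

Lemma lift_orbitD th m n w x :
  lift_orbit th (n + m) w x = lift_orbit th n (iter m T w) (lift_orbit th m w x).
Proof. by elim: n => // n IH; rewrite addSn /= IH iterD. Qed.

Lemma lift_orbitDpi th n w x (k : int) :
  lift_orbit th n w (x + pi * k%:~R) = lift_orbit th n w x + pi * k%:~R.
Proof. by elim: n => //= n ->; rewrite hangleDpi_int addrAC. Qed.

Lemma lift_orbit_mono th n w : {mono lift_orbit th n w : x y / x < y}.
Proof. by elim: n => //= n IH x y; rewrite ltrD2r hangle_mono// IH. Qed.

Lemma lift_orbit_mono_le th n w : {mono lift_orbit th n w : x y / x <= y}.
Proof. by move=> x y; rewrite !leNgt lift_orbit_mono. Qed.

Lemma lift_orbit_angle_le n w x : {homo (fun th => lift_orbit th n w x) : a b / a <= b}.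
Proof.
move=> a b ab; elim: n => //= n IH.
by rewrite lerD// hangle_mono_le.
Qed.

Lemma lift_orbit_angle_lt n w x : {homo (fun th => lift_orbit th n.+1 w x) : a b / a < b}.
Proof.
move=> a b ab /=; apply: ler_ltD => //.
by rewrite hangle_mono_le//; exact: (lift_orbit_angle_le _ _ _ (ltW ab)).
Qed.

Lemma lift_orbit_continuous (X : topologicalType) (th : X -> R) (v : X -> Omega)
    (x : X -> R) n (t : X) : continuous g -> continuous T ->
  {for t, continuous th} -> {for t, continuous v} -> {for t, continuous x} ->
  {for t, continuous (fun u => lift_orbit (th u) n (v u) (x u))}.
Proof.
move=> cg cT cth cv cx; elim: n => //= n IH.
apply: cvgD => //.
apply: (@hangle_continuous _ _ (fun u => g (iter n.+1 T (v u)))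
  (fun u => lift_orbit (th u) n (v u) (x u))) => //.
suff ci k : {for t, continuous (fun u => iter k T (v u))}.
  exact: continuous_at_comp cg (ci n.+1).
elim: k => // k IHk.
exact: continuous_at_comp cT IHk.
Qed.

Definition transfer_step a th (v : R * R) : R * R :=
  let p := (expR a + expR (- a)) * v.1 in let q := (expR a - expR (- a)) * v.2 in
  (cos th * p - sin th * q, sin th * p + cos th * q).

Fixpoint transfer th n w (v : R * R) : R * R :=
  if n is m.+1 then transfer_step (g (iter m.+1 T w)) th (transfer th m w v) else v.

Definition transfer_trace th n w : R :=
  (transfer th n w (1, 0)).1 + (transfer th n w (0, 1)).2.

Definition transfer_det th n w : R :=
  (transfer th n w (1, 0)).1 * (transfer th n w (0, 1)).2 -
  (transfer th n w (0, 1)).1 * (transfer th n w (1, 0)).2.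

Lemma transfer_lin th n w a b : transfer th n w (a, b) =
  (a * (transfer th n w (1, 0)).1 + b * (transfer th n w (0, 1)).1,
   a * (transfer th n w (1, 0)).2 + b * (transfer th n w (0, 1)).2).
Proof.
elim: n => [|n IH] /=; first by congr pair; ring.
by rewrite IH /transfer_step /=; congr pair; ring.
Qed.

(** Since [rho] is positive, the parity of the half turns made by the orbit is visible as a sign of
    the image vector. *)
Lemma transfer_polar th n w x : exists2 rho, 0 < rho &
  transfer th n w (cos x, sin x) =
  (rho * cos (lift_orbit th n w x), rho * sin (lift_orbit th n w x)).
Proof.
elim: n => [|n [rho rho0 IH]] /=; first by exists 1 => //; rewrite !mul1r.
set a := g _; set y := lift_orbit _ _ _ _.
have [cy sy] := hangle_polar y (g_gt0 (T (iter n T w))).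
exists (rho * hradius a y); first by rewrite mulr_gt0// hradius_gt0//; exact: g_gt0.
rewrite IH /transfer_step /= cosD sinD.
rewrite -/a in cy sy.
have -> : (expR a + expR (- a)) * (rho * cos y) = rho * (hradius a y * cos (hangle a y)).
  by rewrite cy; ring.
have -> : (expR a - expR (- a)) * (rho * sin y) = rho * (hradius a y * sin (hangle a y)).
  by rewrite sy; ring.
by congr pair; ring.
Qed.

Lemma transfer_det_gt0 th n w : 0 < transfer_det th n w.
Proof.
elim: n => [|n IH]; first by rewrite /transfer_det /=; lra.
have -> : transfer_det th n.+1 w = hdet (g (iter n.+1 T w)) * transfer_det th n w.
  rewrite /transfer_det /= /transfer_step /= /hdet.
  set a := g _.
  transitivity ((cos th ^+ 2 + sin th ^+ 2) * ((expR a + expR (- a)) * (expR a - expR (- a)) *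
  ((transfer th n w (1, 0)).1 * (transfer th n w (0, 1)).2 -
   (transfer th n w (0, 1)).1 * (transfer th n w (1, 0)).2))); first by ring.
  by rewrite cos2Dsin2 mul1r.
by rewrite mulr_gt0// hdet_gt0.
Qed.

(* The unit vector of angle [x] is an eigenvector of eigenvalue [(-1) ^ k * rho]
   with [rho > 0], and the determinant is positive. *)
Lemma transfer_trace_sign th n w x (k : int) :
  lift_orbit th n w x = x + pi * k%:~R -> 0 < (-1) ^ k * transfer_trace th n w.
Proof.
move=> e; have [rho rho0] := transfer_polar th n w x.
rewrite transfer_lin e cosDpi_int sinDpi_int => -[].
have := transfer_det_gt0 th n w; rewrite /transfer_trace /transfer_det.
set m11 := (transfer _ _ _ (1, 0)).1; set m21 := (transfer _ _ _ (1, 0)).2.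
set m12 := (transfer _ _ _ (0, 1)).1; set m22 := (transfer _ _ _ (0, 1)).2.
have : ((-1) ^ k : R) ^+ 2 = 1.
  by rewrite expN1r sqrr_sign.
set s : R := (-1) ^ k => s2 D0 e1 e2.
pose mu := rho * s; have mu2 : mu ^+ 2 = rho ^+ 2 by rewrite exprMn s2 mulr1.
have E1 : (m11 - mu) * cos x = - m12 * sin x by rewrite /mu; lra.
have E2 : (m22 - mu) * sin x = - m21 * cos x by rewrite /mu; lra.
have dc : ((m11 - mu) * (m22 - mu) - m12 * m21) * cos x = 0.
  transitivity (((m11 - mu) * cos x) * (m22 - mu) - m12 * m21 * cos x); first by ring.
  rewrite E1; transitivity (- m12 * ((m22 - mu) * sin x) - m12 * m21 * cos x); first by ring.
  by rewrite E2; ring.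
have ds : ((m11 - mu) * (m22 - mu) - m12 * m21) * sin x = 0.
  transitivity ((m11 - mu) * ((m22 - mu) * sin x) - m12 * m21 * sin x); first by ring.
  rewrite E2; transitivity (- m21 * ((m11 - mu) * cos x) - m12 * m21 * sin x); first by ring.
  by rewrite E1; ring.
have chi : (m11 - mu) * (m22 - mu) - m12 * m21 = 0.
  transitivity (((m11 - mu) * (m22 - mu) - m12 * m21) * cos x * cos x +
    ((m11 - mu) * (m22 - mu) - m12 * m21) * sin x * sin x).
    rewrite -!mulrA -mulrDr -!expr2 cos2Dsin2; ring.
  by rewrite dc ds; ring.
have : 0 < mu * (m11 + m22).
  have -> : mu * (m11 + m22) = mu ^+ 2 + (m11 * m22 - m12 * m21).
    transitivity (mu ^+ 2 + (m11 * m22 - m12 * m21) -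
      ((m11 - mu) * (m22 - mu) - m12 * m21)); first by ring.
    by rewrite chi; ring.
  by rewrite addr_gt0// mu2 exprn_gt0.
by rewrite /mu -mulrA pmulr_rgt0.
Qed.

(* Cayley-Hamilton: the square of a matrix of trace zero is scalar. *)
Lemma transfer_trace_involution th n w x : transfer_trace th n w = 0 ->
  exists k : int, lift_orbit th n w (lift_orbit th n w x) = x + pi * k%:~R.
Proof.
move=> tr0; set y := lift_orbit th n w x.
suff s0 : sin (lift_orbit th n w y - x) = 0.
  by have [k kE] := sin_eq0_int s0; exists k; rewrite -kE addrC subrK.
have [r1 r10] := transfer_polar th n w x; have [r2 r20] := transfer_polar th n w y.
rewrite -/y (transfer_lin _ _ _ (cos x) (sin x)) (transfer_lin _ _ _ (cos y) (sin y)) => -[] c2 s2 [] c1 s1.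
set z := lift_orbit th n w y in c2 s2 *.
move: tr0 c1 s1 c2 s2; rewrite /transfer_trace.
set m11 := (transfer _ _ _ (1, 0)).1; set m21 := (transfer _ _ _ (1, 0)).2.
set m12 := (transfer _ _ _ (0, 1)).1; set m22 := (transfer _ _ _ (0, 1)).2.
move=> tr0 c1 s1 c2 s2; have m22E : m22 = - m11 by lra.
apply: (mulfI (lt0r_neq0 r10)); apply: (mulfI (lt0r_neq0 r20)); rewrite !mulr0 sinB.
transitivity (r1 * (r2 * sin z) * cos x - r1 * (r2 * cos z) * sin x); first by ring.
rewrite -c2 -s2.
transitivity (((r1 * cos y) * m21 + (r1 * sin y) * m22) * cos x -
  ((r1 * cos y) * m11 + (r1 * sin y) * m12) * sin x); first by ring.
by rewrite -c1 -s1 m22E; ring.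
Qed.

(** The number of half turns completed by the orbit of [x]; its growth in [th] counts the zeros of
    the trace. *)
Definition level n w x th : int := Num.floor ((lift_orbit th n w x - x) / pi).

Lemma level_itv n w x th :
  x + pi * (level n w x th)%:~R <= lift_orbit th n w x
    < x + pi * (level n w x th)%:~R + pi.
Proof.
have := floor_itv ((lift_orbit th n w x - x) / pi); rewrite -/(level n w x th).
have p0 := @pi_gt0 R.
rewrite ler_pdivlMr// ltr_pdivrMr// rmorphD/= => /andP[k1 k2]; apply/andP; split; lra.
Qed.

Lemma level_le n w x : {homo level n w x : a b / a <= b}.
Proof.
move=> a b ab; apply: le_floor.
by rewrite ler_pM2r ?invr_gt0 ?pi_gt0// lerD2r lift_orbit_angle_le.
Qed.

(** With [k] the level, the image of [x] lies strictly between [x + k pi] and [x + (k + 1) pi], as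
    equality would give a nonzero trace. By monotonicity the second image lies strictly between
    [x + 2 k pi] and [x + (2 k + 2) pi], and it differs from [x] by a multiple of [pi]. *)
Lemma transfer_trace0_level th n w x : transfer_trace th n w = 0 ->
  lift_orbit th n w (lift_orbit th n w x) = x + pi * (level n w x th *+ 2 + 1)%:~R.
Proof.
move=> tr0; have p0 := @pi_gt0 R.
have [j jE] := transfer_trace_involution x tr0.
have /andP[] := level_itv n w x th; set k := level n w x th.
rewrite le_eqVlt => /orP[/eqP ek|k1] k2.
  by have := transfer_trace_sign (esym ek); rewrite tr0 mulr0 ltxx.
have l1 : lift_orbit th n w x + pi * k%:~R < lift_orbit th n w (lift_orbit th n w x).
  by rewrite -lift_orbitDpi lift_orbit_mono.
have l2 : lift_orbit th n w (lift_orbit th n w x) < lift_orbit th n w x + pi * k%:~R + pi.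
  have -> : lift_orbit th n w x + pi * k%:~R + pi = lift_orbit th n w x + pi * (k + 1)%:~R.
    by rewrite rmorphD/=; ring.
  by rewrite -lift_orbitDpi lift_orbit_mono rmorphD/=; lra.
rewrite jE in l1 l2 *; congr (_ + pi * _%:~R).
have j1 : (k *+ 2)%:~R < j%:~R :> R.
  by rewrite rmorphMn/= -(ltr_pM2l p0); lra.
have j2 : j%:~R < (k *+ 2 + 2)%:~R :> R.
  by rewrite rmorphD rmorphMn/= -(ltr_pM2l p0); lra.
by move: j1 j2; rewrite !ltr_int; lia.
Qed.

(** At a zero the level determines the second image, which is strictly increasing in [th] as soon as
    there is at least one step. *)
Lemma transfer_trace0_level_inj n w x th th' :
  transfer_trace th n.+1 w = 0 -> transfer_trace th' n.+1 w = 0 ->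
  level n.+1 w x th = level n.+1 w x th' -> th = th'.
Proof.
wlog lt_th : th th' / th < th'.
  move=> H t0 t0' l; case: (ltgtP th th') => // lt; first exact: H.
  by apply/esym/H.
move=> t0 t0' l; exfalso.
have := transfer_trace0_level x t0; have := transfer_trace0_level x t0'.
rewrite l => <- e.
suff : lift_orbit th n.+1 w (lift_orbit th n.+1 w x) <
  lift_orbit th' n.+1 w (lift_orbit th' n.+1 w x) by rewrite e ltxx.
apply: lt_trans (lift_orbit_angle_lt _ _ _ lt_th) _.
by rewrite lift_orbit_mono lift_orbit_angle_lt.
Qed.

Lemma transfer_trace_continuous n w : continuous (fun th => transfer_trace th n w).
Proof.
have H v : continuous (fun th => (transfer th n w v).1) /\
           continuous (fun th => (transfer th n w v).2).
  elim: n => [|n [IH1 IH2]] /=; first by split => ?; exact: cvg_cst.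
  split=> t.
  - apply: cvgB; apply: cvgM; (try exact: continuous_cos); (try exact: continuous_sin);
    by apply: cvgM; [exact: cvg_cst|by [exact: IH1|exact: IH2]].
  - apply: cvgD; apply: cvgM; (try exact: continuous_cos); (try exact: continuous_sin);
    by apply: cvgM; [exact: cvg_cst|by [exact: IH1|exact: IH2]].
by move=> t; apply: cvgD; [exact: (H (1, 0)).1|exact: (H (0, 1)).2].
Qed.

(** The intermediate value theorem is applied first to the orbit, giving angles [t1 < t2] where
    exactly [k] and [k + 1] half turns are made, then to the trace, which has opposite signs
    there. *)
Lemma transfer_trace0_exists n w x a b (k : int) : continuous g -> continuous T ->
  a <= b -> level n w x a < k < level n w x b ->
  exists2 th, a <= th <= b & transfer_trace th n w = 0 /\ level n w x th = k.
Proof.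
move=> cg cT ab /andP[ak kb]; have p0 := @pi_gt0 R.
have cl : continuous (fun th => lift_orbit th n w x).
  by move=> t; apply: lift_orbit_continuous => //; exact: cvg_cst.
have att (j : int) : (level n w x a < j)%R -> (j <= level n w x b)%R ->
    exists2 th, th \in `[a, b] & lift_orbit th n w x = x + pi * j%:~R.
  move=> j1 j2; apply: IVT => //; first exact: continuous_subspaceT.
  have la := lift_orbit_angle_le n w x ab.
  rewrite (min_idPl la) (max_idPr la).
  have /andP[_ la2] := level_itv n w x a; have /andP[lb1 _] := level_itv n w x b.
  apply/andP; split.
  - apply: ltW; apply: lt_le_trans la2 _; rewrite -addrA lerD2l.
    have : (level n w x a + 1)%:~R <= j%:~R :> R by rewrite ler_int; lia.
    by rewrite rmorphD/=; nra.
  - apply: le_trans lb1; rewrite lerD2l ler_pM2l// ler_int//.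
have [t1 t1ab e1] := att k ak (ltW kb).
have ak' : level n w x a < k + 1 by lia.
have kb' : (k + 1 <= level n w x b)%R by lia.
have [t2 t2ab e2] := att (k + 1) ak'  kb'.
have s1 := transfer_trace_sign e1; have s2 := transfer_trace_sign e2.
have t12 : t1 < t2.
  rewrite ltNge; apply/negP => /(lift_orbit_angle_le n w x).
  by rewrite e1 e2 rmorphD/=; lra.
have [th] : exists2 th, th \in `[t1, t2] & transfer_trace th n w = 0.
  apply: IVT; first exact: ltW.
    by apply: continuous_subspaceT => ?; exact: transfer_trace_continuous.
  move: s2; rewrite exprzDr ?unitrN1// expr1z mulrN1 mulNr oppr_gt0.
  have : ((-1) ^ k : R) = 1 \/ ((-1) ^ k : R) = -1.
    by rewrite expN1r -signr_odd; case: odd; [right|left].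
  case=> sE; rewrite sE ?mul1r ?mulN1r in s1 *; move=> s2.
  - by rewrite ge_min le_max (ltW s2) (ltW s1) orbT.
  - by rewrite ge_min le_max; apply/andP; split; apply/orP; [left|right]; lra.
rewrite in_itv/= => /andP[lt1 lt2] tr0.
have := t1ab; have := t2ab; rewrite !in_itv/= => /andP[_ bt2] /andP[at1 _].
have ab1 : a <= th <= b by rewrite (le_trans at1 lt1) (le_trans lt2 bt2).
exists th; first by [].
split => //.
have n1 : t1 != th by apply/eqP => e; move: s1; rewrite e tr0 mulr0 ltxx.
have n2 : th != t2 by apply/eqP => e; move: s2; rewrite -e tr0 mulr0 ltxx.
apply: floor_def.
rewrite ler_pdivlMr// ltr_pdivrMr//.
have l1 := lift_orbit_angle_le n w x lt1; have l2 := lift_orbit_angle_le n w x lt2.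
rewrite e1 in l1; rewrite e2 in l2.
apply/andP; split; first by lra.
rewrite lt_neqAle; apply/andP; split; last by lra.
apply/eqP => e; have e3 : lift_orbit th n w x = x + pi * (k + 1)%:~R by lra.
by have := transfer_trace_sign e3; rewrite tr0 mulr0 ltxx.
Qed.

End transfer.

(** * The partition function as a trace *)

Section chain.
Variables (C : comNzRingType) (S : finType) (K : nat -> S -> S -> C).

(** The entries of the ordered matrix product [K (n - 1) ... K 0], later factors on the left. *)
Fixpoint chain_weight n (b a : S) : C :=
  if n is m.+1 then \sum_c K m b c * chain_weight m c a else (b == a)%:R.

(** The arbitrary function [f] of both end states makes the induction work: the last edge is
    absorbed into it. *)
Lemma sum_open_chain n (f : S -> S -> C) :
  \sum_(s : {ffun 'I_n.+1 -> S})
    (\prod_(i < n) K i (s (lift ord0 i)) (s (widen_ord (leqnSn n) i))) *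
    f (s ord_max) (s ord0) =
  \sum_b \sum_a chain_weight n b a * f b a.
Proof.
elim: n f => [|n IH] f.
  transitivity (\sum_b f b b).
    rewrite (reindex (fun b : S => [ffun _ : 'I_1 => b])); last first.
      exists (fun s : {ffun 'I_1 -> S} => s ord0) => s _; first by rewrite ffunE.
      by apply/ffunP => i; rewrite ffunE; congr (s _); apply/val_inj; case: i => -[].
    by apply: eq_bigr => b _; rewrite big_ord0 mul1r !ffunE.
  apply: eq_bigr => b _; rewrite (bigD1 b)//= eqxx mul1r big1 ?addr0// => a /negbTE ab.
  by rewrite eq_sym ab mul0r.
pose join (p : S * {ffun 'I_n.+1 -> S}) : {ffun 'I_n.+2 -> S} :=
  [ffun i => if unlift ord_max i is Some j then p.2 j else p.1].
rewrite (reindex join); last first.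
  exists (fun s : {ffun 'I_n.+2 -> S} =>
    (s ord_max, [ffun j : 'I_n.+1 => s (lift ord_max j)])).
    move=> [b s] _; rewrite /join/=; congr pair; first by rewrite ffunE unlift_none.
    by apply/ffunP => j; rewrite !ffunE liftK.
  move=> s _; apply/ffunP => i; rewrite ffunE/=.
  by case: unliftP => [j ->|->]; rewrite ?ffunE.
rewrite -(pair_bigA _ (fun b s => (\prod_(i < n.+1) K i (join (b, s) (lift ord0 i))
   (join (b, s) (widen_ord (leqnSn n.+1) i))) *
   f (join (b, s) ord_max) (join (b, s) ord0)))/=.
transitivity (\sum_b \sum_(s : {ffun 'I_n.+1 -> S})
   (\prod_(i < n) K i (s (lift ord0 i)) (s (widen_ord (leqnSn n) i))) *
   (K n b (s ord_max) * f b (s ord0))).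
  apply: eq_bigr => b _; apply: eq_bigr => s _.
  have jmax : join (b, s) ord_max = b by rewrite ffunE unlift_none.
  have jlow (i : 'I_n.+1) j : val j = val i -> join (b, s) j = s i.
    move=> ji; have -> : j = lift ord_max i.
      by apply: val_inj; rewrite ji /= /bump leqNgt ltn_ord.
    by rewrite ffunE liftK.
  rewrite jmax (jlow ord0)// big_ord_recr /= -mulrA; congr (_ * (K _ _ _ * _)).
  - apply: eq_bigr => i _; congr (K _ _ _); last exact: jlow.
    by apply: jlow; rewrite /= /bump /=.
  - by rewrite (_ : lift _ _ = ord_max) ?jmax//; apply: val_inj.
  - by apply: jlow.
apply: eq_bigr => b _; rewrite (IH (fun c a => K n b c * f b a)) exchange_big/=.
apply: eq_bigr => a _; rewrite mulr_suml.
by apply: eq_bigr => c _; ring.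
Qed.

(** Taking the edge from the last site back to the first as [f] turns the open chain into a
    trace. *)
Lemma sum_closed_chain n :
  \sum_(s : {ffun 'I_n.+1 -> S}) \prod_(i < n.+1) K i (s (ordS i)) (s i) =
  \sum_a chain_weight n.+1 a a.
Proof.
transitivity (\sum_(s : {ffun 'I_n.+1 -> S})
    (\prod_(i < n) K i (s (lift ord0 i)) (s (widen_ord (leqnSn n) i))) *
    K n (s ord0) (s ord_max)).
  apply: eq_bigr => s _; rewrite big_ord_recr /=; congr (_ * K _ (s _) _).
    apply: eq_bigr => i _; congr (K _ (s _) _); apply: val_inj => /=.
    by rewrite /bump /= modn_small// ltnS.
  by apply: val_inj; rewrite /= modnn.
rewrite (sum_open_chain _ (fun b a => K n a b)) exchange_big/=.
by apply: eq_bigr => a _; apply: eq_bigr => c _; rewrite mulrC.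
Qed.

End chain.

Section partition_function.
Local Open Scope complex_scope.
Variables (R : realType) (Omega : pmetricType R) (T : homeo Omega) (g : Omega -> R).
Implicit Types (th : R) (w : Omega).

Let edge th w (i : nat) (b' b : bool) : R[i] :=
  (expR (g (iter i.+1 T w) * (spin b' * spin b)%:~R))%:C * cis th ^ spin b'.

Lemma cisV th : (cis th)^-1 = cis (- th).
Proof.
have e : cis th * cis (- th) = 1.
  rewrite /cis cosN sinN; apply/eqP; rewrite eq_complex/=; apply/andP; split; apply/eqP.
    by rewrite mulrN opprK -!expr2 cos2Dsin2.
  by ring.
have c0 : cis th != 0 by apply/eqP => c0; move: e; rewrite c0 mul0r => /eqP; rewrite eq_sym oner_eq0.
by rewrite -[RHS](mulKf c0) e mulr1.
Qed.

Lemma partition_function_chain th w n :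
  partition_function T g n.+1 (cis th) w = \sum_a chain_weight (edge th w) n.+1 a a.
Proof.
rewrite -sum_closed_chain; apply: eq_bigr => s _.
rewrite big_split big_split/=; congr (_ * _).
  by apply: eq_bigr => i _; rewrite [spin (s i) * _]mulrC.
(* A cyclic shift moves each factor [zeta ^ spin] from a site to the edge that ends there. *)
rewrite (reindex_inj (@ordS_inj n.+1)) /=.
by [].
Qed.

(* In the spin basis the matrix [[a, b], [c, d]] becomes the one with rows
   [((a + d) + i (c - b)) / 2, ((a - d) + i (c + b)) / 2] and the conjugates. *)
Let entry (p q : R) : R[i] := (p / 2) +i* (q / 2).

(** In the spin basis the rotation by [th] becomes [diag(e^(i th), e^(- i th))] and the diagonal
    matrix becomes the symmetric one with entries [e^g] and [e^-g], so one edge is one transfer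
    step. *)
Lemma chain_weight_transfer th w n :
  let u := transfer T g th n w (1, 0) in let v := transfer T g th n w (0, 1) in
  [/\ chain_weight (edge th w) n false false = entry (u.1 + v.2) (u.2 - v.1),
      chain_weight (edge th w) n false true = entry (u.1 - v.2) (u.2 + v.1),
      chain_weight (edge th w) n true false = entry (u.1 - v.2) (- (u.2 + v.1)) &
      chain_weight (edge th w) n true true = entry (u.1 + v.2) (- (u.2 - v.1))].
Proof.
elim: n => [|n [e1 e2 e3 e4]] /=.
  split; apply/eqP; rewrite eq_complex/=; apply/andP; split; apply/eqP; lra.
set u := transfer _ _ _ _ _ (1, 0) in e1 e2 e3 e4 *.
set v := transfer _ _ _ _ _ (0, 1) in e1 e2 e3 e4 *.
have edgeE (b' b : bool) : edge th w n b' b =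
    (expR ((if b' == b then 1 else -1) * g (iter n.+1 T w)))%:C *
    (if b' then cis (- th) else cis th).
  have spinE : (spin b' * spin b)%:~R = (if b' == b then 1 else -1) :> R.
    by case: (b'); case: (b).
  by rewrite /edge spinE [g _ * _]mulrC; congr (_ * _); case: (b'); rewrite -?cisV.
rewrite !big_bool /= e1 e2 e3 e4 !edgeE /= !mulN1r !mul1r.
set a := g _; rewrite /entry /transfer_step /cis cosN sinN /=.
by split; apply/eqP; rewrite eq_complex/=; apply/andP; split; apply/eqP; field.
Qed.

Lemma partition_function_cis th w n :
  partition_function T g n.+1 (cis th) w = (transfer_trace T g th n.+1 w)%:C.
Proof.
rewrite partition_function_chain big_bool /=.
have [/= e1 _ _ e4] := chain_weight_transfer th w n.+1.
rewrite !big_bool /= in e1 e4 *; rewrite e1 e4 /transfer_trace /=.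
by rewrite /entry; apply/eqP; rewrite eq_complex/=; apply/andP; split; apply/eqP; field.
Qed.

End partition_function.

(** * Angles for points and arcs of the unit circle *)

Section unit_circle.
Local Open Scope complex_scope.
Variable R : realType.
Implicit Types (a b : R) (z : R[i]).

Lemma cis_surj z : `|z| = 1 -> exists a, z = cis a.
Proof.
case: z => x y; rewrite normc_def => /eqP; rewrite eq_complex/= => /andP[/eqP e _].
have xy1 : x ^+ 2 + y ^+ 2 = 1.
  by rewrite -[LHS]sqr_sqrtr ?addr_ge0 ?sqr_ge0// e expr1n.
have x1 : -1 <= x <= 1 by apply/andP; split; nra.
have cx : cos (acos x) = x by apply: acosK; rewrite in_itv.
have sx : sin (acos x) ^+ 2 = y ^+ 2 by rewrite sin2cos2 cx; lra.
have /orP[/eqP s|/eqP s] : (sin (acos x) == y) || (sin (acos x) == - y) by rewrite -eqf_sqr sx.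
- by exists (acos x); rewrite /cis cx s.
- by exists (- acos x); rewrite /cis cosN sinN cx s opprK.
Qed.

Lemma cis_eq a b : cis a = cis b -> exists k : int, a - b = pi * (k *+ 2)%:~R.
Proof.
move=> /eqP; rewrite eq_complex/= => /andP[/eqP c /eqP s].
have s0 : sin (a - b) = 0 by rewrite sinB c s; ring.
have c1 : cos (a - b) = 1 by rewrite cosB c s -!expr2 cos2Dsin2.
have [j jE] := sin_eq0_int s0.
move: c1; rewrite jE -[pi * _]add0r cosDpi_int cos0 mulr1.
rewrite expN1r -signr_odd; case oj : (odd `|j|%N); rewrite /= ?expr1.
  by move=> h; exfalso; lra.
move=> _; exists (j %/ 2)%Z; rewrite add0r; congr (_ * _%:~R).
by lia.
Qed.

Lemma cis_periodic a (k : int) : cis (a + pi * (k *+ 2)%:~R) = cis a.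
Proof.
rewrite /cis cosDpi_int sinDpi_int.
have -> : (-1) ^ (k *+ 2) = 1 :> R.
  by rewrite expN1r -signr_odd (_ : odd _ = false)//; lia.
by rewrite !mul1r.
Qed.

Lemma circle_arc_endpoints z1 z2 : `|z1| = 1 -> `|z2| = 1 ->
  exists a t, [/\ 0 <= t < 2 * pi, z1 = cis a & z2 = cis (a + t)].
Proof.
move=> /cis_surj[a ->] /cis_surj[b ->]; have p0 := @pi_gt0 R.
exists a; pose k := Num.floor ((b - a) / (2 * pi)).
exists (b - a - pi * (k *+ 2)%:~R).
have := floor_itv ((b - a) / (2 * pi)); rewrite -/k.
have p2 : 0 < 2 * pi :> R by lra.
rewrite ler_pdivlMr// ltr_pdivrMr// rmorphD/= => /andP[k1 k2].
split => //; first by rewrite rmorphMn/=; apply/andP; split; lra.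
by rewrite (_ : a + _ = b + pi * (- k *+ 2)%:~R) ?cis_periodic// mulNrn rmorphN/=; ring.
Qed.

Lemma circle_arcE a t : 0 <= t < 2 * pi ->
  circle_arc (cis a) (cis (a + t)) = [set cis (a + s) | s in [set s | 0 <= s <= t]].
Proof.
move=> /andP[t0 t1]; have p0 := @pi_gt0 R; apply/seteqP; split => [z|_ [s /= st <-]]; last first.
  by exists a, s, t.
move=> [b [s [u [/andP[s0 su] u2 /cis_eq[k kE] -> /cis_eq[j jE]]]]].
(* Both lengths lie in [[0, 2 pi)] and agree modulo full turns. *)
have ut : u = t.
  have : u - t = pi * ((k - j) *+ 2)%:~R.
    by rewrite mulrnBl rmorphB/= mulrBr -kE -jE; ring.
  rewrite rmorphMn/= => e.
  suff /eqP : k - j = 0 by rewrite subr_eq0 => /eqP kj; move: e; rewrite kj subrr mul0rn mulr0; lra.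
  have e1 : (k - j)%:~R < 1%:~R :> R by rewrite -(ltr_pM2l p0); lra.
  have e2 : (-1)%:~R < (k - j)%:~R :> R by rewrite -(ltr_pM2l p0) rmorphN1; lra.
  by move: e1 e2; rewrite !ltr_int; lia.
exists s; first by rewrite /= s0 -ut su.
by rewrite (_ : b + s = a + s + pi * (- k *+ 2)%:~R) ?cis_periodic// mulNrn rmorphN/= mulrN -kE; ring.
Qed.

End unit_circle.

(** * Counting zeros on an arc, and the effect of a spectral gap *)

Section zeros.
Local Open Scope complex_scope.
Variables (R : realType) (Omega : pmetricType R) (T : homeo Omega) (g : Omega -> R).
Hypotheses (g_gt0 : forall w, 0 < g w) (g_cont : continuous g).
Implicit Types (th a : R) (w : Omega).

Let T_cont : continuous (T : Omega -> Omega) := @homeo_continuous _ T.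

Lemma partition_zeros_cis th w n :
  partition_zeros T g n.+1 w (cis th) <-> transfer_trace T g th n.+1 w = 0.
Proof.
rewrite /partition_zeros /= partition_function_cis; split => [[_ /eqP]|->].
  by rewrite eq_complex/= => /andP[/eqP].
split => //; apply/eqP => c0.
have : cis th * (cis th)^-1 = 0 by rewrite c0 mul0r.
rewrite cisV /cis cosN sinN => /eqP; rewrite eq_complex/= => /andP[/eqP].
by rewrite mulrN opprK -!expr2 cos2Dsin2 => /eqP; rewrite oner_eq0.
Qed.

(** Zeros have distinct levels, and each level strictly between the end levels is that of a zero.
    With [D] the difference of the end levels, the count is therefore at most [D + 1] and at least
    [D - 1]. *)
Lemma zero_count_level a t w n : 0 <= t < 2 * pi ->
  `|(zero_count T g (cis a) (cis (a + t)) w n.+1)%:Z -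
    (level T g n.+1 w 0 (a + t) - level T g n.+1 w 0 a)| <= 1.
Proof.
move=> /[dup] t02 /andP[t0 t2]; rewrite /zero_count circle_arcE//.
pose S := [set s | 0 <= s <= t /\ transfer_trace T g (a + s) n.+1 w = 0].
have -> : [set cis (a + s) | s in [set s | 0 <= s <= t]] `&` partition_zeros T g n.+1 w =
    [set cis (a + s) | s in S].
  apply/seteqP; split => [_ [[s /= st <-] /partition_zeros_cis z0]|_ [s [st /partition_zeros_cis z0] <-]].
    by exists s.
  by split => //; exists s.
have inj : {in S &, injective (fun s => cis (a + s))}.
  move=> s s'; rewrite !in_setE => -[/andP[s1 s2] _] [/andP[s3 s4] _] /cis_eq[k].
  have p0 := @pi_gt0 R; rewrite rmorphMn/= => kE.
  have e1 : k%:~R < 1%:~R :> R by rewrite -(ltr_pM2l p0); lra.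
  have e2 : (-1)%:~R < k%:~R :> R by rewrite -(ltr_pM2l p0) rmorphN1; lra.
  have k0 : k = 0 by move: e1 e2; rewrite !ltr_int; lia.
  by move: kE; rewrite k0 mul0rn mulr0; lra.
set A := [set _ | _ in S].
have AS : (A #= S)%card by exact: inj_card_eq.
set L1 := level _ _ _ _ _ a; set L2 := level _ _ _ _ _ (a + t).
have L12 : L1 <= L2 by apply: level_le => //; rewrite lerDl.
pose f s := `|level T g n.+1 w 0 (a + s) - L1|%N.
pose D := `|L2 - L1|%N; have DE : D%:Z = L2 - L1 by rewrite /D; lia.
have fb s : 0 <= s <= t -> L1 <= level T g n.+1 w 0 (a + s) <= L2.
  by move=> /andP[s0 st]; rewrite !level_le// ?lerDl// lerD2l.
have finj : {in S &, injective f}.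
  move=> s s'; rewrite !in_setE => -[/fb sb s0] [/fb sb' s0'] ff.
  have : a + s = a + s'; last by move/addrI.
  apply: (transfer_trace0_level_inj g_gt0 s0 s0' (x := 0)).
  by move: ff sb sb'; rewrite /f; lia.
have SI : (S #<= `I_D.+1)%card.
  apply: (@card_le_trans _ _ _ (f @` S)).
    by rewrite -(card_le_eql (inj_card_eq finj)).
  apply: subset_card_le => _ [s [/fb sb _] <-] /=.
  by move: sb; rewrite /f /D; lia.
have AI : (A #<= `I_D.+1)%card by rewrite (card_le_eql AS).
have Afin : finite_set A by apply: card_le_finite AI _; exact: finite_II.
have up : (#|` fset_set A| <= D.+1)%N by exact: geq_card_fset_set.
have lo : (D.-1 <= #|` fset_set A|)%N.
  apply: leq_card_fset_set => //; rewrite (card_le_eqr AS).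
  (* The levels known to be attained are [L1 + 1, ..., L2 - 1]; the predecessor numbers them from
     [0]. *)
  apply: card_le_trans (card_image_le (fun s => (f s).-1) S).
  apply: subset_card_le => i /= iD.
  have at0 : a <= a + t by rewrite lerDl.
  have [|th /andP[th1 th2] [th0 lth]] := @transfer_trace0_exists _ _ T g g_gt0
    n.+1 w 0 a (a + t) (L1 + i.+1%:Z) g_cont T_cont at0.
    by rewrite -/L1 -/L2; lia.
  exists (th - a); first by split; rewrite ?subr_ge0 ?th1/= 1?lerBlDl// subrKC.
  by rewrite /f subrKC lth; lia.
by move: up lo; lia.
Qed.

(** A level strictly between those at [th0 - d] and [th0 + d] would produce a zero in the gap. Hence
    the level rises by at most one, and the orbits differ by less than two half turns. *)
Lemma gap_separation (mu : probability (borel Omega) R) th0 :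
  in_spectral_gap T mu g (cis th0) ->
  exists d, [/\ 0 < d, d < pi / 2 &
    {ae mu, forall w, \forall N \near \oo, forall x,
      lift_orbit T g (th0 + d) N w x < lift_orbit T g (th0 - d) N w x + pi *+ 2}].
Proof.
move=> [e e0 ae_gap]; have p0 := @pi_gt0 R.
have : \forall th \near th0, (cos th - cos th0) ^+ 2 + (sin th - sin th0) ^+ 2 < e ^+ 2.
  pose f th := (cos th - cos th0) ^+ 2 + (sin th - sin th0) ^+ 2.
  have f0 : f th0 = 0 by rewrite /f !subrr !expr0n addr0.
  have cf : {for th0, continuous f}.
    apply: cvgD; apply: (@continuous_cvg _ _ _ _ _ _ (fun x : R => x ^+ 2)); (try exact: exprn_continuous);
    apply: cvgB; (try exact: cvg_cst); [exact: continuous_cos|exact: continuous_sin].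
  by apply: (cvgr_lt _ cf); rewrite f0 exprn_gt0.
move=> /nbhs_ballP[r /= r0 rP].
(* Half the radius keeps the closed interval around [th0] inside the ball; [pi / 4] ensures
   [d < pi / 2]. *)
pose d := Num.min (r / 2) (pi / 4).
have d0 : 0 < d by rewrite lt_min !divr_gt0.
have dr : d < r by rewrite gt_min ltr_pdivrMr// ltr_pMr ?ltr1n.
have dpi : d < pi / 2 by rewrite gt_min; apply/orP; right; lra.
exists d; split => //.
have close th : th0 - d <= th <= th0 + d -> `|cis th - cis th0| < e%:C.
  move=> thd; have /rP : ball th0 r th.
    by rewrite /ball/= distrC ltr_norml; lra.
  move=> lt_e; rewrite normc_def ltcR/= -(ger0_norm (ltW e0)) -sqrtr_sqr ltr_sqrt//.
  by rewrite exprn_gt0.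
move: ae_gap; apply: (@filterS _ _ (ae_filter_ringOfSetsType mu)) => w.
move=> [n0 _ gap0]; exists n0.+1 => // -[//|n] n0n x.
have gapN := gap0 n.+1 (leqW n0n).
have nz th : th0 - d <= th <= th0 + d -> transfer_trace T g th n.+1 w <> 0.
  by move=> thd tr0; apply: (gapN (cis th)); [exact: close|exact/partition_zeros_cis].
have lt_d : th0 - d <= th0 + d by lra.
have : level T g n.+1 w x (th0 + d) <= level T g n.+1 w x (th0 - d) + 1.
  rewrite leNgt; apply/negP => lt_l.
  have [|th thd [tr0 _]] := @transfer_trace0_exists _ _ T g g_gt0 n.+1 w x _ _
    (level T g n.+1 w x (th0 - d) + 1) g_cont T_cont lt_d; first by rewrite lt_l; lia.
  exact: nz tr0.
rewrite -(ler_int R) rmorphD/= -(ler_pM2l p0) mulrDr mulr1 => l.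
have /andP[_ l2] := level_itv T g n.+1 w x (th0 + d).
have /andP[l1 _] := level_itv T g n.+1 w x (th0 - d).
apply: lt_le_trans l2 _; rewrite -(lerD2r (pi *+ 2)) in l1.
by apply: le_trans l1; rewrite -!addrA lerD2l mulr2n; lra.
Qed.

End zeros.

(** * Confined angles and the invariant section *)

Section expansion.
Variable R : realType.
Implicit Types x y p q g d : R.

Lemma cotB x y : sin x != 0 -> sin y != 0 ->
  cos x / sin x - cos y / sin y = sin (y - x) / (sin x * sin y).
Proof. by move=> x0 y0; rewrite sinB; field; rewrite x0 y0. Qed.

(** The cotangent of the angle from [x] is an affine coordinate on the lines other than that of [x],
    and a matrix acts affinely in it. The factor is the derivative of [hangle g] at [x]. *)
Lemma cotB_hangle g x p q : 0 < g -> sin (p - x) != 0 -> sin (q - x) != 0 ->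
  let h := hangle g in
  hdet g / hradius g x ^+ 2 *
    (cos (h p - h x) / sin (h p - h x) - cos (h q - h x) / sin (h q - h x)) =
  cos (p - x) / sin (p - x) - cos (q - x) / sin (q - x).
Proof.
move=> g0 p0 q0 h; have D0 := hdet_gt0 g0.
have rx := hradius_gt0 x g0; have rp := hradius_gt0 p g0; have rq := hradius_gt0 q g0.
have ep := sin_hangleB x p g0; have eq := sin_hangleB x q g0; have epq := sin_hangleB p q g0.
rewrite -/h in ep eq epq.
have hp : sin (h p - h x) = hdet g * sin (p - x) / (hradius g x * hradius g p).
  by rewrite -ep; field; rewrite !gt_eqF.
have hq : sin (h q - h x) = hdet g * sin (q - x) / (hradius g x * hradius g q).
  by rewrite -eq; field; rewrite !gt_eqF.
have hpq : sin (h q - h p) = hdet g * sin (q - p) / (hradius g p * hradius g q).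
  by rewrite -epq; field; rewrite !gt_eqF.
have hp0 : sin (h p - h x) != 0.
  rewrite hp; apply: mulf_neq0; first by rewrite mulf_neq0// lt0r_neq0.
  by rewrite invr_neq0// lt0r_neq0// mulr_gt0.
have hq0 : sin (h q - h x) != 0.
  rewrite hq; apply: mulf_neq0; first by rewrite mulf_neq0// lt0r_neq0.
  by rewrite invr_neq0// lt0r_neq0// mulr_gt0.
rewrite !cotB//.
have -> : h q - h x - (h p - h x) = h q - h p by ring.
have -> : q - x - (p - x) = q - p by ring.
rewrite hp hq hpq.
move: (sin (p - x)) (sin (q - x)) (sin (q - p)) p0 q0 => sp sq spq p0 q0.
by field; rewrite p0 q0 !lt0r_neq0.
Qed.

(** The drop equals [sin d / (sin x * sin (x + d))], whose denominator is at most [1]. *)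
Lemma cot_drop x d : 0 < d -> 0 < x -> x + d < pi ->
  cos (x + d) / sin (x + d) <= cos x / sin x - sin d.
Proof.
move=> d0 x0 xd; have sx : 0 < sin x by apply: sin_gt0_pi; lra.
have sxd : 0 < sin (x + d) by apply: sin_gt0_pi; lra.
have sd : 0 < sin d by apply: sin_gt0_pi; lra.
suff : sin d <= cos x / sin x - cos (x + d) / sin (x + d) by lra.
rewrite cotB ?gt_eqF// addrAC subrr add0r ler_pdivlMr ?mulr_gt0//.
by rewrite -[leRHS]mulr1 ler_pM2l// mulr_ile1// ?ltW// sin_le1.
Qed.

End expansion.

Section gap_section.
Variables (R : realType) (Omega : pmetricType R) (T : homeo Omega) (g : Omega -> R).
Hypotheses (g_gt0 : forall w, 0 < g w) (g_cont : continuous g).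
Variables (th0 d : R).
Hypotheses (d_gt0 : 0 < d) (d_lt : d < pi / 2).
Implicit Types (w : Omega) (x y : R).

Let T_cont : continuous (T : Omega -> Omega) := @homeo_continuous _ T.

Local Notation lift := (lift_orbit T g).

(* The angles whose [2 d]-wide cone of perturbed orbits never opens up to more
   than a half turn. *)
Definition confined w x :=
  forall n, lift (th0 + d) n w x <= lift (th0 - d) n w x + pi.

Lemma lift1D th n w x : lift th n.+1 w x = lift th n (T w) (lift th 1 w x).
Proof. by rewrite -addn1 lift_orbitD. Qed.

(** A step driven by [th0] lies between those driven by [th0 - d] and [th0 + d], so later orbits
    stay sandwiched. *)
Lemma confined_step w x : confined w x -> confined (T w) (lift th0 1 w x).
Proof.
move=> cx n; apply: le_trans (_ : lift (th0 + d) n.+1 w x <= _).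
  rewrite (lift1D _ n w) lift_orbit_mono_le//.
  by apply: (lift_orbit_angle_le T g_gt0 1 w x (_ : th0 <= th0 + d)); rewrite lerDl ltW.
apply: le_trans (cx _) _; rewrite lerD2r (lift1D _ n w).
rewrite lift_orbit_mono_le//.
by apply: (lift_orbit_angle_le T g_gt0 1 w x (_ : th0 - d <= th0)); rewrite gerBl ltW.
Qed.

Lemma confinedDpi w x (k : int) : confined w (x + pi * k%:~R) <-> confined w x.
Proof.
suff H y j : confined w y -> confined w (y + pi * j%:~R).
  split; last exact: H.
  by move=> /(H _ (- k)); rewrite rmorphN/= mulrN addrK.
by move=> cy n; rewrite !lift_orbitDpi addrAC lerD2r.
Qed.

(** A step preserves order and commutes with the half turn, and the two driving angles add a further
    [2 * d]. *)
Lemma opening_persists m n w x : (m <= n)%N ->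
  lift (th0 - d) m w x + pi < lift (th0 + d) m w x ->
  lift (th0 - d) n w x + pi < lift (th0 + d) n w x.
Proof.
have d0 := d_gt0; move=> /subnK <-; elim: (n - m)%N => // k IH /IH lt; rewrite addSn /=.
rewrite addrAC -hangleDpi; apply: ltrD; last by lra.
by rewrite hangle_mono.
Qed.

(* The cotangents of the angles from the orbit of [x] to the orbits driven by
   [th0 + d] and [th0 - d] differ by some [D j >= 0]; each step divides [D] by
   the local expansion rate of angles and then lowers it by at least [2 sin d]. *)
Lemma confined_sum w x (c : nat -> R) m : confined w x ->
  (forall j, (j < m)%N -> 0 < c j /\ c j.+1 = c j *
     (hdet (g (iter j.+1 T w)) / hradius (g (iter j.+1 T w)) (lift th0 j w x) ^+ 2)) ->
  (0 < m)%N ->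
  \sum_(j < m.-1) c j.+2 <= cos d / sin d ^+ 2 * c 1%N.
Proof.
move=> cx crec m0; have p0 := @pi_gt0 R; have d0 := d_gt0; have d1 := d_lt.
have sd : 0 < sin d by apply: sin_gt0_pi; lra.
have cd : 0 < cos d by apply: cos_gt0_pihalf; lra.
have c0 j : (j <= m)%N -> 0 < c j.
  case: j => [|j] jm; first by have [] := crec 0%N m0.
  have [cj0 ->] := crec j jm.
  by rewrite mulr_gt0// divr_gt0 ?hdet_gt0// exprn_gt0// hradius_gt0.
pose X j := lift th0 j w x.
pose P j := lift (th0 + d) j w x.
(* The shift by [pi] keeps the line and gives [X < P <= Q < X + pi] from step [1] on, where all
   sines are positive. *)
pose Q j := lift (th0 - d) j w x + pi.
pose D j := cos (P j - X j) / sin (P j - X j) - cos (Q j - X j) / sin (Q j - X j).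
have order j : [/\ X j.+1 < P j.+1, P j.+1 <= Q j.+1 & Q j.+1 < X j.+1 + pi].
  split; [|exact: cx|by rewrite ltrD2r; apply: lift_orbit_angle_lt => //; lra].
  by apply: lift_orbit_angle_lt => //; lra.
have D0 j : 0 <= D j.+1.
  have [xp pq qx] := order j.
  have sp : 0 < sin (P j.+1 - X j.+1) by apply: sin_gt0_pi; lra.
  have sq : 0 < sin (Q j.+1 - X j.+1) by apply: sin_gt0_pi; lra.
  rewrite /D cotB ?gt_eqF// divr_ge0 ?mulr_ge0 ?(ltW sp) ?(ltW sq)//.
  by apply: sin_ge0_pi; lra.
have Dstep j : (j.+1 < m)%N -> c j.+2 * D j.+2 <= c j.+1 * D j.+1 - 2 * sin d * c j.+2.
  move=> jm; have [xp pq qx] := order j; have [xp' pq' qx'] := order j.+1.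
  have [c1 c2] := crec j.+1 jm.
  set a := g _ in c2; have a0 : 0 < a by exact: g_gt0.
  have XE : X j.+2 = hangle a (X j.+1) + th0 by [].
  have PE : P j.+2 = hangle a (P j.+1) + (th0 + d) by [].
  have QE : Q j.+2 = hangle a (Q j.+1) + (th0 - d).
    by rewrite /Q [X in hangle a X]/= hangleDpi /=; rewrite addrAC.
  have sp : 0 < sin (P j.+1 - X j.+1) by apply: sin_gt0_pi; lra.
  have sq : 0 < sin (Q j.+1 - X j.+1) by apply: sin_gt0_pi; lra.
  have := cotB_hangle a0 (lt0r_neq0 sp) (lt0r_neq0 sq).
  rewrite -/(D j.+1) /= => <-.
  have hp : hangle a (X j.+1) < hangle a (P j.+1) by rewrite hangle_mono.
  have hq : hangle a (Q j.+1) < hangle a (X j.+1) + pi.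
    by rewrite -hangleDpi hangle_mono.
  set u := hangle a (P j.+1) - hangle a (X j.+1).
  set v := hangle a (Q j.+1) - hangle a (X j.+1).
  have e1 : P j.+2 - X j.+2 = u + d by rewrite PE XE /u; ring.
  have e2 : Q j.+2 - X j.+2 = v - d by rewrite QE XE /v; ring.
  have b1 : cos (P j.+2 - X j.+2) / sin (P j.+2 - X j.+2) <= cos u / sin u - sin d.
    by rewrite e1; apply: cot_drop => //; rewrite /u; lra.
  have b2 : cos v / sin v + sin d <= cos (Q j.+2 - X j.+2) / sin (Q j.+2 - X j.+2).
    have := @cot_drop _ (v - d) d d_gt0; rewrite subrK e2 => /(_ _ _)/= b2.
    by rewrite -lerBrDr; apply: b2; rewrite /v; lra.
  rewrite mulrA -c2 [2 * _ * _]mulrC -mulrBr ler_pM2l ?c0//.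
  by rewrite /D; lra.
have c10 : 0 < c 1%N by exact: c0.
(* All three orbits start at [x], where the cotangents degenerate; after one step [P] and [Q] are
   ahead of [X] by [d] and [pi - d]. *)
have D1 : D 1%N = 2 * (cos d / sin d).
  have e1 : P 1%N - X 1%N = d by rewrite /P /X /=; ring.
  have e2 : Q 1%N - X 1%N = pi - d by rewrite /Q /X /=; ring.
  rewrite /D e1 e2 [pi - d]addrC cosDpi sinDpi cosN sinN; field; exact: lt0r_neq0.
have H j : (j < m)%N -> c j.+1 * D j.+1 + 2 * sin d * (\sum_(i < j) c i.+2) <= c 1%N * D 1%N.
  elim: j => [|j IH] jm; first by rewrite big_ord0 mulr0 addr0.
  apply: le_trans (IH (ltnW jm)).
  by rewrite big_ord_recr /= (mulrDr (2 * sin d)) addrCA [leRHS]addrC lerD2l -lerBrDr Dstep.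
have mm : (m.-1 < m)%N by rewrite prednK.
have := H m.-1 mm; rewrite D1 => H1.
have : 2 * sin d * \sum_(i < m.-1) c i.+2 <= c 1%N * (2 * (cos d / sin d)).
  by apply: le_trans H1; rewrite lerDr mulr_ge0// ltW// c0// prednK.
rewrite -ler_pdivlMl ?mulr_gt0// => /le_trans; apply.
by rewrite le_eqVlt; apply/orP; left; apply/eqP; field; exact: lt0r_neq0.
Qed.

(** The backward orbit driven by [th0]: an angle over [w] is carried to one over the [n]-th preimage
    of [w]. *)
Fixpoint back n w x : R :=
  if n is m.+1 then hangle_inv (g (iter m (homeo_inv T) w)) (back m w x - th0) else x.

Local Notation Tinv := (homeo_inv T).

Lemma lift_back n w x :
  lift th0 1 (iter n.+1 Tinv w) (back n.+1 w x) = back n w x.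
Proof. by rewrite /= homeo_invK hangle_invK// subrK. Qed.

Lemma lift_back_iter k n w x :
  lift th0 k (iter (k + n) Tinv w) (back (k + n) w x) = back n w x.
Proof.
elim: k => // k IH; rewrite addSn lift1D lift_back -[RHS]IH; congr (lift _ _ _ _).
by rewrite iterS homeo_invK.
Qed.

Lemma iter_back k n w : iter k T (iter (k + n) Tinv w) = iter n Tinv w.
Proof. by elim: k => // k IH; rewrite iterSr addSn iterS homeo_invK. Qed.

Lemma backSr n w x : back n.+1 w x = back n (Tinv w) (back 1 w x).
Proof. by elim: n => // n IH; rewrite /= -/(back n.+1 w x) IH -iterSr. Qed.

Lemma backK n w x : back n w (lift th0 n (iter n Tinv w) x) = x.
Proof.
elim: n w x => // n IH w x; rewrite backSr iterSr /=.
rewrite -[RHS](IH (Tinv w)) addrK; congr back.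
have -> : T (iter n T (iter n Tinv (Tinv w))) = w.
  by rewrite -{2}[n]addn0 iter_back /= homeo_invK.
by rewrite hangleK.
Qed.

Lemma backDpi n w x (k : int) : back n w (x + pi * k%:~R) = back n w x + pi * k%:~R.
Proof.
elim: n => //= n ->; rewrite /hangle_inv.
have -> : back n w x + pi * k%:~R - th0 - pi / 2 = back n w x - th0 - pi / 2 + pi * k%:~R by ring.
by rewrite hangleDpi_int addrAC.
Qed.

Lemma back_continuous n (p : Omega * R) :
  {for p, continuous (fun q : Omega * R => (iter n Tinv q.1, back n q.1 q.2))}.
Proof.
have ci m : {for p, continuous (fun q : Omega * R => iter m Tinv q.1)}.
  elim: m => [|m IH]; first exact: cvg_fst.
  exact: continuous_at_comp (@homeo_inv_continuous _ T) IH.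
have cb : {for p, continuous (fun q : Omega * R => back n q.1 q.2)}.
  elim: n => [|n IH]; first exact: cvg_snd.
  apply: cvgD; last exact: cvg_cst.
  apply: (@hangle_continuous _ _ (fun q => g (iter n Tinv q.1))
    (fun q => back n q.1 q.2 - th0 - pi / 2)) => //.
    exact: continuous_at_comp g_cont (ci n).
  by apply: cvgB; [apply: cvgB => //; exact: cvg_cst|exact: cvg_cst].
exact: cvg_pair (ci n) cb.
Qed.

Lemma opening_open n (p : Omega * R) :
  lift (th0 - d) n p.1 p.2 + pi < lift (th0 + d) n p.1 p.2 ->
  \forall q \near p, lift (th0 - d) n q.1 q.2 + pi < lift (th0 + d) n q.1 q.2.
Proof.
move=> lt; pose f (q : Omega * R) := lift (th0 + d) n q.1 q.2 - (lift (th0 - d) n q.1 q.2 + pi).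
have cl th : {for p, continuous (fun q : Omega * R => lift th n q.1 q.2)}.
  apply: (@lift_orbit_continuous _ _ _ _ g_gt0 _ (fun=> th) fst snd _ _ g_cont T_cont).
  - exact: cvg_cst.
  - exact: cvg_fst.
  - exact: cvg_snd.
have cf : {for p, continuous f}.
  by apply: cvgB; [exact: cl|apply: cvgD; [exact: cl|exact: cvg_cst]].
have : \forall q \near p, 0 < f q by apply: (cvgr_gt _ cf); rewrite subr_gt0.
by apply: filterS => q; rewrite subr_gt0.
Qed.

Lemma not_confined w x : ~ confined w x ->
  exists n, lift (th0 - d) n w x + pi < lift (th0 + d) n w x.
Proof. by move=> /existsNP[n /negP]; rewrite -ltNge => lt; exists n. Qed.

(** Failure of confinement is a strict inequality at one finite time, and the orbits are
    continuous. *)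
Lemma not_confined_open (p : Omega * R) : ~ confined p.1 p.2 ->
  \forall q \near p, ~ confined q.1 q.2.
Proof.
move=> /not_confined[n /opening_open]; apply: filterS => q lt /(_ n).
by rewrite leNgt lt.
Qed.

Lemma not_confined_back_open n w x : ~ confined (iter n Tinv w) (back n w x) ->
  \forall q \near (w, x), ~ confined (iter n Tinv q.1) (back n q.1 q.2).
Proof.
move=> nc; exact: (@back_continuous n (w, x) _
  (@not_confined_open (iter n Tinv w, back n w x) nc)).
Qed.

(** Angles whose whole backward orbit is confined; existence and uniqueness modulo [pi] will make
    them an invariant section. *)
Definition section_point w x := forall n, confined (iter n Tinv w) (back n w x).

Lemma section_point_step w x : section_point w x ->
  section_point (T w) (lift th0 1 w x).
Proof.
move=> sx [|n]; first exact/confined_step/(sx 0%N).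
rewrite iterSr homeoK backSr.
have -> : back 1 (T w) (lift th0 1 w x) = x by rewrite /= addrK hangleK.
by rewrite homeoK; exact: sx.
Qed.

Lemma section_pointDpi w x (k : int) : section_point w x -> section_point w (x + pi * k%:~R).
Proof. by move=> sx n; rewrite backDpi; apply/confinedDpi. Qed.

Lemma not_section_point_open (p : Omega * R) : ~ section_point p.1 p.2 ->
  \forall q \near p, ~ section_point q.1 q.2.
Proof.
case: p => w x /existsNP[n /not_confined_back_open].
by apply: filterS => q /= nq /(_ n).
Qed.

Lemma mod_pi x : exists k : int, 0 <= x + pi * k%:~R <= pi.
Proof.
exists (- Num.floor (x / pi)); have p0 := @pi_gt0 R.
have := floor_itv (x / pi); rewrite ler_pdivlMr// ltr_pdivrMr// !rmorphD/= rmorphN/=.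
by move=> /andP[? ?]; apply/andP; split; lra.
Qed.

(** Otherwise compactness of [[0, pi]] gives one [n] for which no angle over [w] has a confined
    [n]-th backward image. Pushing a confined angle over the [n]-th preimage of [w] forward
    contradicts this. *)
Lemma section_point_exists w : (forall v, exists x, confined v x) ->
  exists x, section_point w x.
Proof.
move=> cex; apply: contrapT => /forallNP nsp.
have := @segment_compact R 0 pi; rewrite compact_near_coveringP.
move=> /(_ nat \oo (fun n x => ~ confined (iter n Tinv w) (back n w x)) _)[].
  move=> x _; have /existsNP[n nc] := nsp x.
  have [[A B] /= [Aw Bx] AB] := not_confined_back_open nc.
  exists (B, [set m | (n <= m)%N]); first by split => //; exists n.
  move=> [y m] /= [By nm] cm; apply: (AB (w, y)); first by split => //; exact: nbhs_singleton.
  (* Confinement passes forward, so its failure at backward time [n] entails failure at every later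
     [m]. *)
  move: cm; rewrite -(subnK nm); elim: (m - n)%N => // k IH ck; apply: IH.
  by have := confined_step ck; rewrite addSn lift_back /= homeo_invK.
move=> n _ /(_ n (leqnn n)) nc; have [y cy] := cex (iter n Tinv w).
have [k kE] := mod_pi (lift th0 n (iter n Tinv w) y).
by apply: (nc _ kE); rewrite backDpi backK; apply/confinedDpi.
Qed.

(** The derivative at [x] of the backward map [back n w]: each factor is the reciprocal of the
    derivative of [hangle] at [back i.+1 w x]. *)
Definition shrink w x n : R := \prod_(i < n)
  (hradius (g (iter i Tinv w)) (back i.+1 w x) ^+ 2 / hdet (g (iter i Tinv w))).

Lemma shrink_gt0 w x n : 0 < shrink w x n.
Proof.
by apply: prodr_gt0 => i _; rewrite divr_gt0 ?hdet_gt0// exprn_gt0// hradius_gt0.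
Qed.

(* Bounding the partial sums by the next term forces growth. *)
Lemma shrink_sum w x n : section_point w x ->
  \sum_(i < n) shrink w x i <= cos d / sin d ^+ 2 * shrink w x n.
Proof.
move=> sx.
(* [confined_sum] is applied to the forward orbit from the preimage [n + 1] steps back; its step [j]
   has backward index [n + 1 - j]. *)
have : \sum_(j < n) shrink w x (n.+1 - j.+2) <=
    cos d / sin d ^+ 2 * shrink w x (n.+1 - 1).
  apply: (@confined_sum (iter n.+1 Tinv w) (back n.+1 w x)
    (fun j => shrink w x (n.+1 - j)) n.+1 (sx _)) => // j jn.
  split; first exact: shrink_gt0.
  have jn' : (j <= n)%N by rewrite -ltnS.
  have e1 : iter j.+1 T (iter n.+1 Tinv w) = iter (n - j) Tinv w.
    by rewrite -{1}(subnKC jn') -addSn iter_back.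
  have e2 : lift th0 j (iter n.+1 Tinv w) (back n.+1 w x) = back (n - j).+1 w x.
    by rewrite -{1 2}(subnKC jn') -addnS lift_back_iter.
  rewrite e1 e2 subSS subSn// /shrink big_ord_recr /=.
  have r0 := hradius_gt0 (back (n - j).+1 w x) (g_gt0 (iter (n - j) Tinv w)).
  have h0 := hdet_gt0 (g_gt0 (iter (n - j) Tinv w)).
  rewrite -mulrA -[LHS]mulr1; congr (_ * _).
  by move: r0 h0 => /= /lt0r_neq0 r0 /lt0r_neq0 h0; field; rewrite r0 h0.
by rewrite subn1 /= [in X in _ -> X](reindex_inj rev_ord_inj).
Qed.

(** This iterates [sin_hangleB] along the backward orbits; squares let the two derivatives enter
    without roots. *)
Lemma shrink_sin w x y n :
  sin (back n w y - back n w x) ^+ 2 = shrink w x n * shrink w y n * sin (y - x) ^+ 2.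
Proof.
elim: n => [|n IH]; first by rewrite /shrink !big_ord0 !mul1r.
have /= e := sin_hangleB (back n.+1 w x) (back n.+1 w y) (g_gt0 (iter n Tinv w)).
rewrite /= !hangle_invK// in e.
have h0 := lt0r_neq0 (hdet_gt0 (g_gt0 (iter n Tinv w))).
have -> : sin (back n.+1 w y - back n.+1 w x) =
  sin (back n w y - back n w x) * (hradius (g (iter n Tinv w)) (back n.+1 w x) *
    hradius (g (iter n Tinv w)) (back n.+1 w y)) / hdet (g (iter n Tinv w)).
  rewrite -[_ - _ in RHS](_ : back n w y - th0 - (back n w x - th0) = _); last by ring.
  by rewrite e; field.
have rec z : shrink w z n.+1 = shrink w z n *
    (hradius (g (iter n Tinv w)) (back n.+1 w z) ^+ 2 / hdet (g (iter n Tinv w))).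
  by rewrite /shrink big_ord_recr.
rewrite !rec; move: (hradius _ (back n.+1 w x)) (hradius _ (back n.+1 w y)) => rx ry.
move: h0 IH; move: (hdet _) => h h0 IH.
transitivity (sin (back n w y - back n w x) ^+ 2 * (rx * ry / h) ^+ 2); first by field.
by rewrite IH; field.
Qed.

(** By [shrink_sum] each derivative is at least [1 / K], and reinserting this in the sum gives
    linear growth. If the lines differed, [shrink_sin] would make a squared sine exceed [1]. *)
Lemma section_point_uniq w x y : section_point w x -> section_point w y ->
  exists k : int, y = x + pi * k%:~R.
Proof.
move=> sx sy; have p0 := @pi_gt0 R; have d0 := d_gt0; have d1 := d_lt.
suff /sin_eq0_int[k kE] : sin (y - x) = 0 by exists k; rewrite -kE addrC subrK.
have sd : 0 < sin d by apply: sin_gt0_pi; lra.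
have cd : 0 < cos d by apply: cos_gt0_pihalf; lra.
pose K := cos d / sin d ^+ 2; have K0 : 0 < K by rewrite divr_gt0// exprn_gt0.
have lo z n : section_point w z -> K^-1 <= shrink w z n.+1.
  move=> sz; rewrite -[K^-1]mulr1 ler_pdivrMl//; apply: le_trans (shrink_sum n.+1 sz).
  rewrite big_ord_recl {1}/shrink big_ord0 lerDl sumr_ge0// => i _.
  exact/ltW/shrink_gt0.
have grow z n : section_point w z -> n%:R * K^-1 * K^-1 <= shrink w z n.+1.
  move=> sz; rewrite ler_pdivrMr// [leRHS]mulrC; apply: le_trans (shrink_sum n.+1 sz).
  rewrite big_ord_recl /= -[leLHS]add0r lerD//; first exact/ltW/shrink_gt0.
  rewrite mulr_natl -[n in _ *+ n]card_ord -sumr_const ler_sum// => i _.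
  by apply: le_trans (lo z i sz).
apply/eqP; rewrite -sqrf_eq0; apply/eqP/le_anti; rewrite sqr_ge0 andbT.
rewrite leNgt; apply/negP => s0.
set s := sin _ ^+ 2 in s0; have e0 : 0 < K^-1 ^+ 3 * s by rewrite mulr_gt0// exprn_gt0// invr_gt0.
pose n := Num.bound (K^-1 ^+ 3 * s)^-1.
have nb : (K^-1 ^+ 3 * s)^-1 < n%:R.
  by apply: archi_boundP; rewrite invr_ge0 ltW.
have := shrink_sin w x y n.+1; rewrite -/s => e.
have : sin (back n.+1 w y - back n.+1 w x) ^+ 2 <= 1 by rewrite sin2cos2 gerBl sqr_ge0.
rewrite e; apply/negP; rewrite -ltNge.
apply: lt_le_trans (_ : n%:R * K^-1 * K^-1 * K^-1 * s <= _); last first.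
  rewrite ler_pM2r//; apply: ler_pM; rewrite ?grow ?lo//; last by rewrite invr_ge0 ltW.
  by rewrite !mulr_ge0// ?invr_ge0 ltW.
have -> : n%:R * K^-1 * K^-1 * K^-1 * s = n%:R * (K^-1 ^+ 3 * s) by ring.
by rewrite -ltr_pdivrMr// mul1r.
Qed.

End gap_section.

(** * Borel measurability and recurrence *)

Section borel.
Variable R : realType.

Lemma open_borel (X : ptopologicalType) (A : set X) : open A ->
  measurable (A : set (borel X)).
Proof. exact: sub_sigma_algebra. Qed.

Lemma continuous_borel (X Y : ptopologicalType) (f : X -> Y) : continuous f ->
  measurable_fun [set: borel X] (f : borel X -> borel Y).
Proof.
move=> /continuousP cf; apply: (@measurability _ _ (borel X) (borel Y) setT f (@open Y) erefl) => _ [B oB <-].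
rewrite setTI; apply: open_borel; exact: cf.
Qed.

Lemma continuous_borel_real (X : ptopologicalType) (f : X -> R) : continuous f ->
  measurable_fun [set: borel X] (f : borel X -> R).
Proof.
move=> /continuousP cf; apply: (@measurability _ _ (borel X) _ setT f _ (measurable_realfun.RGenOpens.measurableE R)).
by move=> _ [_ [a [b ->]] <-]; rewrite setTI; apply: open_borel; apply: cf; exact: interval_open.
Qed.

End borel.

Section recurrence.
Variables (R : realType) (Omega : pmetricType R) (T : homeo Omega).
Variable mu : probability (borel Omega) R.
Hypothesis mu_invariant : invariant_measure T mu.

Lemma iter_homeo_measurable n :
  measurable_fun [set: borel Omega] (iter n T : borel Omega -> borel Omega).
Proof.
apply: continuous_borel => w; elim: n => [|n IH]; first exact: cvg_id.
exact: continuous_at_comp (@homeo_continuous _ T) IH.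
Qed.

Lemma iter_homeo_preimage n (A : set (borel Omega)) : measurable A ->
  measurable (iter n T @^-1` A : set (borel Omega)).
Proof.
move=> mA; have := @iter_homeo_measurable n measurableT A mA.
by rewrite setTI.
Qed.

Lemma invariant_iter n (A : set (borel Omega)) : measurable A ->
  mu (iter n T @^-1` A) = mu A.
Proof.
move=> mA; elim: n => // n IH; rewrite -[RHS]IH.
rewrite -(mu_invariant (iter_homeo_preimage n mA)); congr (mu _).
by apply/seteqP; split => w /=; rewrite -iterSr.
Qed.

(** Without such a return, the preimages of [V] under multiples of [N + 1] steps would be disjoint
    with equal positive measure, too much for total mass [1]. *)
Lemma poincare_recurrence (V : set (borel Omega)) N : measurable V ->
  (0 < mu V)%E -> exists w j, [/\ (N <= j)%N, V w & V (iter j T w)].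
Proof.
move=> mV V0; apply: contrapT => nrec.
pose A i := iter (i * N.+1)%N T @^-1` V.
have mA i : measurable (A i : set (borel Omega)) by exact: iter_homeo_preimage.
have tA : trivIset setT A.
  suff H i j w : (i < j)%N -> A i w -> A j w -> False.
    apply/trivIsetP => i j _ _ ij; apply/seteqP; split => // w [Ai Aj].
    by case: (ltngtP i j) ij => // lt _; [exact: H lt Ai Aj|exact: H lt Aj Ai].
  move=> ij Ai Aj; apply: nrec; exists (iter (i * N.+1) T w), ((j - i) * N.+1)%N.
  split => //; first by rewrite (leq_trans (leqnSn N))// leq_pmull// subn_gt0.
  by rewrite -iterD -mulnDl subnK// ltnW.
have sum1 n : (\sum_(i < n) mu (A i) <= 1)%E.
  rewrite -measure_bigsetU_ord//; last first.
    move=> i j _ _ ij; apply: val_inj; exact: tA ij.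
  by apply: probability_le1; apply: bigsetU_measurable.
have muV : mu V \is a fin_num by rewrite fin_num_measure.
pose v := fine (mu V); have v0 : 0 < v by rewrite fine_gt0// V0 ltey_eq muV.
have := sum1 (Num.bound v^-1).
rewrite (eq_bigr (fun=> v%:E)); last by move=> i _; rewrite invariant_iter// fineK.
rewrite sumEFin lee_fin sumr_const card_ord -mulr_natl leNgt => /negP; apply.
rewrite -ltr_pdivrMr// mul1r; apply: archi_boundP.
by rewrite invr_ge0 ltW.
Qed.

End recurrence.

(** * Confined angles over every point, and a section continuous modulo [pi] *)

Section invariant_section.
Variables (R : realType) (Omega : pmetricType R) (T : homeo Omega) (g : Omega -> R).
Hypotheses (g_gt0 : forall w, 0 < g w) (g_cont : continuous g).
Variable mu : probability (borel Omega) R.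
Hypothesis mu_invariant : invariant_measure T mu.
Hypothesis mu_support : measure_support mu = [set: Omega].
Variables (th0 d : R).
Hypotheses (d_gt0 : 0 < d) (d_lt : d < pi / 2).
Hypothesis separation : {ae mu, forall w, \forall N \near \oo, forall x,
  lift_orbit T g (th0 + d) N w x < lift_orbit T g (th0 - d) N w x + pi *+ 2}.

(* Otherwise, by compactness, the perturbed orbits open up by [pi] along all
   orbits starting near [w]; recurrence makes this happen twice, contradicting
   [separation]. *)
Lemma confined_exists w : exists x, confined T g th0 d w x.
Proof.
apply: contrapT => /forallNP ncw.
have p0 := @pi_gt0 R.
have [N [V [oV Vw]] openV] : exists N, exists2 V : set Omega, open V /\ V w &
    forall v x n, V v -> (N <= n)%N ->
      lift_orbit T g (th0 - d) n v x + pi < lift_orbit T g (th0 + d) n v x.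
  have := @segment_compact R 0 pi; rewrite compact_near_coveringP.
  move=> /(_ _ (filter_prod (nbhs w) \oo) (fun p x =>
    lift_orbit T g (th0 - d) p.2 p.1 x + pi < lift_orbit T g (th0 + d) p.2 p.1 x) _)[].
    move=> x _; have [n ncx] := not_confined (ncw x).
    have [[A B] /= [Aw Bx] AB] := opening_open g_gt0 g_cont (p := (w, x)) ncx.
    exists (B, A `*` [set m | (n <= m)%N]).
      by split => //; exists (A, [set m | (n <= m)%N]) => //; split => //; exists n.
    move=> [y [v m]] /= [By [Av nm]]; apply: opening_persists nm _ => //.
    exact: (AB (v, y)).
  move=> [A B] /= [Aw [N _ NB]] AB.
  exists N, (A^°); first by split; [exact: open_interior|exact: Aw].
  move=> v x n Av nN; have [k kE] := mod_pi x.
  have := AB (v, n) (conj (interior_subset Av) (NB _ nN)) (x + pi * k%:~R).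
  rewrite /= in_itv/= => /(_ kE).
  by rewrite !lift_orbitDpi addrAC ltrD2r.
move: separation => [B [mB B0 Bsep]].
pose V' : set (borel Omega) := V.
have muV : (0 < mu V')%E.
  have : measure_support mu w by rewrite mu_support.
  exact.
have mV : measurable V' by exact: open_borel.
have mVB : measurable (V' `\` B) by exact: measurableD.
have muVB : (0 < mu (V' `\` B))%E.
  rewrite lt_neqAle measure_ge0 andbT eq_sym; apply/eqP => VB0.
  have VB00 : mu (V' `&` B) = 0.
    exact: subset_measure0 (measurableI _ _ mV mB) mB (@subIsetr _ V' B) B0.
  have VE : mu V' = (mu (V' `\` B) + mu (V' `&` B))%E by exact: measureDI.
  by move: muV; rewrite VE VB0 VB00 adde0 ltxx.
have [v [j [Nj [Vv Bv] [Vjv _]]]] := poincare_recurrence mu_invariant N mVB muVB.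
have : ~ ~ (\forall N \near \oo, forall x,
  lift_orbit T g (th0 + d) N v x < lift_orbit T g (th0 - d) N v x + pi *+ 2).
  by move=> /Bsep.
move=> /contrapT[n0 _ sep].
have Nj0 : (n0 <= N + n0 + j)%N by rewrite addnAC leq_addl.
have := sep _ Nj0 0.
rewrite !(lift_orbitD _ _ _ j) => lt.
(* The lower orbit is followed through the return; raised by [pi] it is still below the upper one,
   so the two openings add up. *)
have h1 := openV v 0 j Vv Nj.
have h2 := openV (iter j T v) (lift_orbit T g (th0 - d) j v 0) (N + n0)%N Vjv (leq_addr _ _).
have h3 : lift_orbit T g (th0 + d) (N + n0) (iter j T v) (lift_orbit T g (th0 - d) j v 0 + pi * 1%:~R) <
   lift_orbit T g (th0 + d) (N + n0) (iter j T v) (lift_orbit T g (th0 + d) j v 0).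
  by rewrite lift_orbit_mono// mulr1.
rewrite lift_orbitDpi mulr1 in h3.
by lra.
Qed.

(** Section angles are chosen pointwise and unique modulo [pi], hence invariance and continuity
    modulo [pi]. For continuity, an angle of [[u w, u w + pi]] away from both ends is no section
    angle over [w], which persists nearby, uniformly by compactness. *)
Lemma invariant_section : exists u : Omega -> R,
  (forall w, exists k : int, u (T w) = lift_orbit T g th0 1 w (u w) + pi * k%:~R) /\
  (forall w e, 0 < e -> \forall v \near w, exists k : int, `|u v - u w - pi * k%:~R| < e).
Proof.
have sp w := section_point_exists g_gt0 g_cont d_gt0 w confined_exists.
pose u w := xget 0 [set x | section_point T g th0 d w x].
have su w : section_point T g th0 d w (u w).
  exact: (@xgetPex _ 0 [set x | section_point T g th0 d w x] (sp w)).
exists u; split => [w|w e e0].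
  apply: (section_point_uniq g_gt0 d_gt0 d_lt) (su (T w)).
  exact: section_point_step.
have p0 := @pi_gt0 R.
have cpt : compact `[u w, u w + pi]%classic by exact: segment_compact.
have : \forall v \near w, `[u w, u w + pi]%classic `<=` (fun x =>
    section_point T g th0 d v x -> `|x - u w| < e \/ `|x - u w - pi| < e).
  move/compact_near_coveringP: cpt; apply.
  move=> x; rewrite /= in_itv/= => /andP[x1 x2].
  have near_end (a : R) : `|x - u w - a| < e ->
      \forall x' \near x & i \near w, `|x' - u w - a| < e.
    move=> xa; have cf : {for x, continuous (fun x' => `|x' - u w - a|)}.
      apply: cvg_norm; apply: cvgB; last exact: cvg_cst.
      by apply: cvgB; [exact: cvg_id|exact: cvg_cst].
    have A : \forall x' \near x, `|x' - u w - a| < e by exact: (cvgr_lt _ cf).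
    exists ([set x' | `|x' - u w - a| < e], setT); last by case=> x' v [].
    by split => /=; [exact: A|exact: filterT].
  have [xe|xe] := ltP `|x - u w| e.
    have := near_end 0; rewrite subr0 => /(_ xe).
    by apply: filterS => -[x' v] /=; rewrite subr0; left.
  have [xe'|xe'] := ltP `|x - u w - pi| e.
    by have := near_end pi xe'; apply: filterS => -[x' v] /=; right.
  have nsx : ~ section_point T g th0 d w x.
    move=> /(section_point_uniq g_gt0 d_gt0 d_lt (su w))[k kE].
    have k0 : (0 : int)%:~R <= k%:~R :> R by rewrite -(ler_pM2l p0); lra.
    have k1 : k%:~R <= (1 : int)%:~R :> R by rewrite -(ler_pM2l p0); lra.
    have [ke|ke] : k = 0 \/ k = 1 by move: k0 k1; rewrite !ler_int; lia.
    - by move: xe; rewrite kE ke mulr0 addr0 subrr normr0 leNgt e0.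
    - by move: xe'; rewrite kE ke mulr1 (_ : _ - pi = 0) ?normr0 ?leNgt ?e0//; ring.
  have [[A B] /= [Aw Bx] AB] := not_section_point_open g_gt0 g_cont
    (nsx : ~ section_point T g th0 d (w, x).1 (w, x).2).
  exists (B, A) => // -[x' v] /= [Bx' Av] sv; exfalso.
  exact: (AB (v, x')).
apply: filterS => v Hv.
have [k /andP[k1 k2]] := mod_pi (u v - u w).
have := Hv (u v + pi * k%:~R); rewrite /= in_itv/=.
have -> : u w <= u v + pi * k%:~R <= u w + pi by apply/andP; split; lra.
move=> /(_ isT (section_pointDpi k (su v)))[lt|lt].
- by exists (- k); rewrite rmorphN mulrN opprK addrAC.
- exists (1 - k); rewrite rmorphB/= mulrBr mulr1.
  by move: lt; congr (`|_| < _); ring.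
Qed.

End invariant_section.

(** * Birkhoff's theorem for bounded functions *)

Section birkhoff.
Variables (dX : measure_display) (X : measurableType dX) (R : realType).
Variables (P : probability X R) (T : X -> X).
Hypothesis T_meas : measurable_fun [set: X] T.
Hypothesis T_inv : forall A : set X, measurable A -> P (T @^-1` A) = P A.
Hypothesis T_erg : forall A : set X, measurable A -> T @^-1` A = A ->
  P A = 0%E \/ P A = 1%E.

Definition bounded_mfun (f : X -> R) :=
  measurable_fun [set: X] f /\ exists C, forall x, `|f x| <= C.

Lemma bounded_mfun_integrable f : bounded_mfun f -> P.-integrable [set: X] (EFin \o f).
Proof.
move=> [mf [C fC]]; apply: measurable_bounded_integrable => //.
  exact: le_lt_trans (probability_le1 P measurableT) (ltry 1).
by exists C; split; [exact: num_real|move=> M CM x _; exact: (le_trans (fC x) (ltW CM))].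
Qed.

Lemma bounded_mfun_cst r : bounded_mfun (fun=> r).
Proof. by split => //; exists `|r|. Qed.

Lemma bounded_mfunD f g : bounded_mfun f -> bounded_mfun g -> bounded_mfun (fun x => f x + g x).
Proof.
move=> [mf [C fC]] [mg [D gD]]; split; first exact: measurable_funD.
by exists (C + D) => x; rewrite (le_trans (ler_normD _ _))// lerD.
Qed.

Lemma bounded_mfunN f : bounded_mfun f -> bounded_mfun (fun x => - f x).
Proof.
move=> [mf [C fC]]; split; first exact: measurableT_comp.
by exists C => x; rewrite normrN.
Qed.

Lemma bounded_mfun_max f g : bounded_mfun f -> bounded_mfun g ->
  bounded_mfun (fun x => Num.max (f x) (g x)).
Proof.
move=> [mf [C fC]] [mg [D gD]]; split; first exact: measurable_maxr.
exists (Num.max C D) => x; rewrite le_max.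
by case: (leP (f x) (g x)) => _; rewrite ?fC ?gD ?orbT.
Qed.

Lemma bounded_mfun_comp f : bounded_mfun f -> bounded_mfun (f \o T).
Proof.
move=> [mf [C fC]]; split; first exact: measurableT_comp.
by exists C => x; exact: fC.
Qed.

Local Notation mean := (Rintegral P [set: X]).

Lemma Rintegral_invariant f : bounded_mfun f -> mean (f \o T) = mean f.
Proof.
move=> bf; rewrite /Rintegral; congr fine.
have mEf : measurable_fun [set: X] (EFin \o f) by apply/measurable_EFinP; case: bf.
have iT : P.-integrable (T @^-1` setT) ((EFin \o f) \o T).
  by rewrite preimage_setT; exact: (bounded_mfun_integrable (bounded_mfun_comp bf)).
have := @integral_pushforward _ _ _ _ _ T T_meas P setT (EFin \o f) mEf iT measurableT.
rewrite preimage_setT => <-; apply: eq_measure_integral => A mA _.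
exact: T_inv.
Qed.

Lemma Rintegral_probability_cst r : mean (fun=> r) = r.
Proof.
have P1 : P setT = 1%E by exact: probability_setT.
transitivity (r * fine (P setT)); first exact: Rintegral_cst.
by rewrite P1 mulr1.
Qed.

Lemma Rintegral_le f g : bounded_mfun f -> bounded_mfun g ->
  (forall x, f x <= g x) -> mean f <= mean g.
Proof.
move=> bf bg fg; rewrite -subr_ge0 -RintegralB//; try exact: bounded_mfun_integrable.
by apply: Rintegral_ge0 => x _; rewrite subr_ge0.
Qed.

Definition birkhoff_sum (f : X -> R) n x := \sum_(i < n) f (iter i T x).

Lemma birkhoff_sumS f n x : birkhoff_sum f n.+1 x = f x + birkhoff_sum f n (T x).
Proof.
rewrite /birkhoff_sum big_ord_recl; congr (_ + _).
by apply: eq_bigr => i _; rewrite -iterSr.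
Qed.

Lemma measurable_birkhoff_sum f n : measurable_fun [set: X] f ->
  measurable_fun [set: X] (birkhoff_sum f n).
Proof.
move=> mf; elim: n => [|n IH].
  by rewrite (_ : birkhoff_sum f 0 = cst 0)//; apply/funext => x; rewrite /birkhoff_sum big_ord0.
rewrite (_ : birkhoff_sum f n.+1 = (fun x => f x + (birkhoff_sum f n \o T) x)).
  by apply: measurable_funD => //; exact: measurableT_comp.
by apply/funext => x; rewrite birkhoff_sumS.
Qed.

Section maximal.
Variable f : X -> R.
Hypothesis bf : bounded_mfun f.

(** Recursive form of the maximum of the Birkhoff sums of lengths [0] to [n]. *)
Fixpoint partial_max n x : R :=
  if n is m.+1 then Num.max 0 (f x + partial_max m (T x)) else 0.

Lemma bounded_partial_max n : bounded_mfun (partial_max n).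
Proof.
elim: n => [|n IH] /=; first exact: bounded_mfun_cst.
apply: bounded_mfun_max; first exact: bounded_mfun_cst.
by apply: bounded_mfunD => //; exact: bounded_mfun_comp.
Qed.

Lemma partial_max_ge0 n x : 0 <= partial_max n x.
Proof. by case: n => //= n; rewrite le_max lexx. Qed.

Lemma partial_max_leS n x : partial_max n x <= partial_max n.+1 x.
Proof.
elim: n x => [|n IH] x; first exact: partial_max_ge0.
by rewrite /= ge_max !le_max lexx/= lerD2l IH orbT.
Qed.

Lemma birkhoff_le_partial_max n k x : (k <= n)%N -> birkhoff_sum f k x <= partial_max n x.
Proof.
elim: n k x => [|n IH] [|k] x //= kn.
- by rewrite /birkhoff_sum big_ord0.
- by rewrite /birkhoff_sum big_ord0 le_max lexx.
- by rewrite birkhoff_sumS le_max lerD2l IH ?orbT.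
Qed.

(* Garsia's argument: if the sums were unbounded on a set of full measure, then
   [partial_max n.+1 - partial_max n \o T], whose mean is nonnegative, would
   converge boundedly to [f]. *)
Lemma birkhoff_sum_bounded : mean f < 0 ->
  {ae P, forall x, exists C, forall n, birkhoff_sum f n x <= C}.
Proof.
move=> Ef0.
pose B := \bigcap_(j : nat) \bigcup_(k : nat) [set x | j%:R < birkhoff_sum f k x].
have mB : measurable B.
  apply: bigcapT_measurable => j; apply: bigcupT_measurable => k.
  have := @measurable_birkhoff_sum f k bf.1 measurableT `]j%:R, +oo[%classic (measurable_itv _).
  by rewrite setTI; congr measurable; apply/seteqP; split => x /=; rewrite in_itv/= andbT.
have BE x : B x <-> ~ exists C, forall n, birkhoff_sum f n x <= C.
  split=> [Bx [C Cx]|nC j _].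
    have C0 : 0 <= C by have := Cx 0%N; rewrite /birkhoff_sum big_ord0.
    have [k _ /=] := Bx (Num.bound C) I; rewrite ltNge => /negP; apply.
    by rewrite (le_trans (Cx k))// ltW// archi_boundP.
  apply: contrapT => nk; apply: nC; exists j%:R => n.
  by rewrite leNgt; apply/negP => lt; apply: nk; exists n.
(* The sums along [x] and [T x] differ by the index shift and the constant [f x], so they are
   bounded above together. *)
have TB : T @^-1` B = B.
  apply/seteqP; split => x; rewrite /= !BE => nC [C Cx]; apply: nC.
  - by exists (C - f x) => n; rewrite lerBrDl -birkhoff_sumS.
  - exists (Num.max 0 (C + f x)) => -[|n]; first by rewrite /birkhoff_sum big_ord0 le_max lexx.
    by rewrite birkhoff_sumS addrC le_max lerD2r Cx orbT.
have [PB0|PB1] := T_erg mB TB.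
  exists B; split => // x /= nC; exact/BE.
exfalso.
pose D n x := partial_max n.+1 x - partial_max n (T x).
have bD n : bounded_mfun (D n).
  apply: bounded_mfunD; first exact: bounded_partial_max.
  by apply: bounded_mfunN; exact: (bounded_mfun_comp (bounded_partial_max n)).
have ED n : 0 <= mean (D n).
  rewrite RintegralB//; try exact: bounded_mfun_integrable (bounded_partial_max _).
    rewrite (Rintegral_invariant (bounded_partial_max n)) subr_ge0.
    by apply: Rintegral_le; [exact: bounded_partial_max|exact: bounded_partial_max|exact: partial_max_leS].
  exact: (bounded_mfun_integrable (bounded_mfun_comp (bounded_partial_max n))).
have DE n x : D n x = Num.max (- partial_max n (T x)) (f x).
  by rewrite /D /= addr_maxl sub0r addrK.
have Df n x : `|D n x| <= `|f x|.
  rewrite DE; have := partial_max_ge0 n (T x); set m := partial_max n _ => m0.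
  case: (leP (- m) (f x)) => // fm.
  by rewrite normrN ger0_norm// ltr0_norm; lra.
(* On [B] the running maximum along [T x] eventually exceeds [|f x|], and from then on [D n x] is
   [f x]. *)
have cvgD x : B x -> (D n x)%:E @[n --> \oo] --> (f x)%:E.
  move=> Bx; apply/cvg_EFin; first by apply: nearW.
  apply: cvg_near_cst.
  have BTx : (T @^-1` B) x by rewrite TB.
  have [k _ /= lk] := BTx (Num.bound `|f x|) I.
  exists k => // n /= kn; rewrite DE; apply/max_idPr.
  rewrite lerNl; apply: le_trans (birkhoff_le_partial_max (T x) kn).
  apply: ltW; apply: le_lt_trans lk; apply: le_trans (ler_norm (- f x)) _.
  by rewrite normrN ltW// archi_boundP.
have cvgE : (fun n => \int[P]_x (D n x)%:E)%E @ \oo --> (\int[P]_x (f x)%:E)%E.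
  have [|||||_ _] := @dominated_convergence _ X R P setT measurableT (fun n => EFin \o D n) (EFin \o f)
    (fun x => `|f x|%:E).
  - by move=> n; apply/measurable_EFinP; exact: (bD n).1.
  - by apply/measurable_EFinP; exact: bf.1.
  - exists (~` B); split; first exact: measurableC.
      transitivity (1 - P B)%E; first exact: probability_setC.
      by rewrite PB1 subee.
    by move=> x /= nc Bx; apply: nc => _; exact: cvgD.
  - exact: (integrable_abse (bounded_mfun_integrable bf)).
  - by apply: aeW => x n _; rewrite lee_fin.
  - exact.
have : (0 <= \int[P]_x (f x)%:E)%E.
  apply: (cvge_ge _ cvgE); apply: nearW => n.
  rewrite -[X in (_ <= X)%E]fineK; last exact: integrable_fin_num (bounded_mfun_integrable (bD n)).
  by rewrite lee_fin; exact: ED.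
rewrite -[X in (_ <= X)%E]fineK; last exact: integrable_fin_num (bounded_mfun_integrable bf).
by rewrite lee_fin leNgt Ef0.
Qed.

End maximal.

(** Subtracting [mean f + e] leaves a function of mean [- e], to which [birkhoff_sum_bounded]
    applies. *)
Lemma birkhoff_upper f e : bounded_mfun f -> 0 < e ->
  {ae P, forall x, exists C, forall n, birkhoff_sum f n x <= C + n%:R * (mean f + e)}.
Proof.
move=> bf e0; pose r := - (mean f + e).
have br : bounded_mfun (fun x => f x + r) by apply: bounded_mfunD => //; exact: bounded_mfun_cst.
have mr : mean (fun x => f x + r) < 0.
  rewrite RintegralD//; try exact: bounded_mfun_integrable; last first.
    exact: (bounded_mfun_integrable (bounded_mfun_cst r)).
  by rewrite Rintegral_probability_cst /r; lra.
have := birkhoff_sum_bounded br mr.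
apply: (@filterS _ _ (ae_filter_ringOfSetsType P)) => x [C Cx]; exists C => n.
have := Cx n; rewrite /birkhoff_sum big_split/= sumr_const card_ord -[r *+ n]mulr_natl.
by rewrite -/r (_ : _ + e = - r) ?opprK// mulrN => h; lra.
Qed.

(** The upper bounds for [f] and [- f] are taken with [e = 1 / (m + 1)] for all [m] at once, which
    costs a single null set. *)
Lemma birkhoff f : bounded_mfun f ->
  {ae P, forall x, n%:R^-1 * birkhoff_sum f n x @[n --> \oo] --> mean f}.
Proof.
move=> bf; have bNf := bounded_mfunN bf.
have mN : mean (fun x => - f x) = - mean f.
  apply/eqP; rewrite -addr_eq0 -RintegralD//; try exact: bounded_mfun_integrable.
  rewrite -[X in _ == X]Rintegral_probability_cst; apply/eqP; congr (mean _).
  by apply/funext => x; rewrite addNr.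
have ae_n (h : X -> R) : bounded_mfun h -> {ae P, forall x, forall m : nat,
    exists C, forall n, birkhoff_sum h n x <= C + n%:R * (mean h + m.+1%:R^-1)}.
  by move=> bh; apply: ae_foralln => m; exact: birkhoff_upper.
have := ae_n _ bf; have := ae_n _ bNf.
apply: (@filterS2 _ _ (ae_filter_ringOfSetsType P)) => x lo up.
apply/cvgrPdist_le => e e0.
pose m := Num.bound (e / 2)^-1.
have me : m.+1%:R^-1 <= e / 2.
  rewrite -[leRHS]invrK lef_pV2 ?posrE ?invr_gt0 ?divr_gt0//.
  rewrite ltW// (lt_le_trans (archi_boundP _)) ?ler_nat//.
  by rewrite invr_ge0 divr_ge0// ltW.
have [C1 lo1] := lo m; have [C2 up2] := up m.
pose C := Num.max C1 C2.
near=> n.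
have n0 : (0 < n)%N by near: n; exists 1%N.
have nR : 0 < n%:R :> R by rewrite ltr0n.
have Cn : C <= n%:R * (e / 2).
  have : C / (e / 2) <= n%:R by near: n; exact: nbhs_infty_ger.
  by rewrite ler_pdivrMr ?divr_gt0.
have CC1 : C1 <= C by rewrite le_max lexx.
have CC2 : C2 <= C by rewrite le_max lexx orbT.
have := lo1 n; have := up2 n; rewrite mN.
have -> : birkhoff_sum (fun x => - f x) n x = - birkhoff_sum f n x by rewrite /birkhoff_sum sumrN.
have nme : n%:R * m.+1%:R^-1 <= n%:R * (e / 2) by rewrite ler_pM2l.
move=> u l.
have -> : mean f - n%:R^-1 * birkhoff_sum f n x = n%:R^-1 * (n%:R * mean f - birkhoff_sum f n x).
  by field; rewrite gt_eqF.
rewrite normrM ger0_norm ?invr_ge0 ?(ltW nR)// ler_pdivrMl//.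
have arith (S I k c1 c2 c i e' : R) : S <= c2 + k * (I + i) ->
    - S <= c1 + k * (- I + i) -> k * i <= k * (e' / 2) -> c <= k * (e' / 2) ->
    c1 <= c -> c2 <= c -> `|k * I - S| <= k * e'.
  by move=> ? ? ? ? ? ?; rewrite ler_norml; apply/andP; split; lra.
exact: arith u l nme Cn CC1 CC2.
Unshelve. all: by end_near. Qed.

End birkhoff.

(** * The suspension and its Schwartzman group *)

Section circle_group.
Variable R : realType.
Local Notation q := (\pi_(circle R)).

Lemma circle_piE (x y : R) : (q x = q y) <-> exists k : int, x = y + k%:~R.
Proof.
split=> [/eqmodP/intrP[k kE]|[k ->]]; first by exists k; rewrite -kE addrC subrK.
by apply/eqmodP; rewrite /= /circle_rel addrAC subrr add0r intr_int.
Qed.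

Lemma circle_pi_surj (c : circle R) : exists x, q x = c.
Proof. by exists (repr c); rewrite reprK. Qed.

Lemma circle_pi_open (U : set R) : open U -> open [set q x | x in U].
Proof.
move=> oU; change (open (q @^-1` [set q x | x in U])).
have -> : q @^-1` [set q x | x in U] = \bigcup_(k : int) [set y | U (y + k%:~R)].
  apply/seteqP; split => [y [x Ux /circle_piE[k kE]]|y [k _ Uy]].
    by exists k => //; rewrite /= -kE.
  by exists (y + k%:~R) => //; apply/circle_piE; exists k.
apply: bigcup_open => k _.
have /continuousP : continuous (fun y : R => y + k%:~R).
  by move=> y; apply: cvgD; [exact: cvg_id|exact: cvg_cst].
exact.
Qed.

Definition circle_sub (c d : circle R) : circle R := q (repr c - repr d).

Lemma circle_sub_pi x y : circle_sub (q x) (q y) = q (x - y).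
Proof.
apply/circle_piE.
have /circle_piE[j jE] : q (repr (q x)) = q x by rewrite reprK.
have /circle_piE[k kE] : q (repr (q y)) = q y by rewrite reprK.
by exists (j - k); rewrite jE kE rmorphB/=; ring.
Qed.

Lemma circle_pi_continuous (X : topologicalType) (f : X -> R) :
  continuous f -> continuous (fun t => q (f t)).
Proof. by move=> cf t; exact: (continuous_at_comp (@pi_continuous _ _) (cf t)). Qed.

Lemma circle_sub_continuous (X : topologicalType) (f h : X -> circle R) :
  continuous f -> continuous h -> continuous (fun t => circle_sub (f t) (h t)).
Proof.
move=> cf ch t A /=; have [x xE] := circle_pi_surj (f t); have [y yE] := circle_pi_surj (h t).
rewrite -xE -yE circle_sub_pi => nA.
have : nbhs (x - y) (q @^-1` A) by exact: (@pi_continuous _ _ (x - y)).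
move=> /nbhs_ballP[e /= e0 eA].
have e20 : 0 < e / 2 by rewrite divr_gt0.
have near_pi z c : q z = c -> nbhs c [set q z' | z' in ball z (e / 2)].
  move=> <-; apply: open_nbhs_nbhs; split; first by apply/circle_pi_open/ball_open.
  by exists z => //; exact: ballxx.
have nf : \forall t' \near t, [set q z' | z' in ball x (e / 2)] (f t').
  exact: (cf t _ (near_pi _ _ xE)).
have nh : \forall t' \near t, [set q z' | z' in ball y (e / 2)] (h t').
  exact: (ch t _ (near_pi _ _ yE)).
change (\forall t' \near t, A (circle_sub (f t') (h t'))).
move: nf nh; apply: filterS2 => t' [x' bx' <-] [y' by' <-]; rewrite circle_sub_pi; apply: eA.
move: bx' by'; rewrite /ball/= => bx' by'.
have -> : x - y - (x' - y') = (x - x') - (y - y') by ring.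
by rewrite (le_lt_trans (ler_normB _ _))// [e]splitr ltrD.
Qed.

End circle_group.

(** * The quotient map of the suspension and its cross section *)

Section suspension_topology.
Variables (R : realType) (Omega : pmetricType R) (T : homeo Omega).
Local Notation q := (\pi_(suspension T)).

Lemma suspension_piE (p p' : Omega * R) :
  q p = q p' <-> exists2 k : int, p.2 - p'.2 = k%:~R & homeo_iter T k p.1 = p'.1.
Proof. by split=> [/eqmodP/asboolP|h]; [|apply/eqmodP/asboolP]. Qed.

Lemma suspension_pi_shift (k : int) w t : q (homeo_iter T k w, t - k%:~R) = q (w, t).
Proof. by apply/esym/suspension_piE; exists k => //=; rewrite opprB addrC subrK. Qed.

Lemma homeo_iter_continuous (k : int) : continuous (homeo_iter T k).
Proof.
case: k => n; elim: n => [|n IH] w /=.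
- exact: cvg_id.
- exact: continuous_at_comp (@homeo_continuous _ T) (IH w).
- exact: homeo_inv_continuous.
- exact: continuous_at_comp (@homeo_inv_continuous _ T) (IH w).
Qed.

Lemma suspension_pi_open (U : set (Omega * R)) : open U -> open [set q p | p in U].
Proof.
move=> oU; change (open (q @^-1` [set q p | p in U])).
have -> : q @^-1` [set q p | p in U] =
    \bigcup_(k : int) [set p | U (homeo_iter T k p.1, p.2 - k%:~R)].
  apply/seteqP; split => [[w t] [[w' t'] Up /esym/suspension_piE[k /= kE wE]]|[w t] [k _ Up]].
    by exists k => //=; rewrite wE -kE opprB addrC subrK.
  by exists (homeo_iter T k w, t - k%:~R) => //; exact: suspension_pi_shift.
apply: bigcup_open => k _.
have /continuousP : continuous (fun p : Omega * R => (homeo_iter T k p.1, p.2 - k%:~R)).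
  move=> p.
  have c1 : {for p, continuous (fun p : Omega * R => homeo_iter T k p.1)}.
    by apply: (continuous_at_comp (@homeo_iter_continuous k)); exact: cvg_fst.
  have c2 : {for p, continuous (fun p : Omega * R => p.2 - k%:~R)}.
    by apply: cvgB; [exact: cvg_snd|exact: cvg_cst].
  exact: cvg_pair c1 c2.
exact.
Qed.

(** The first coordinate of the representative whose time lies in [[0, 1)]. *)
Definition suspension_base (x : suspension T) : Omega :=
  homeo_iter T (Num.floor (repr x).2) (repr x).1.

Lemma suspension_base_pi w t : suspension_base (q (w, t)) = homeo_iter T (Num.floor t) w.
Proof.
rewrite /suspension_base.
have /suspension_piE[k kE wE] : q (repr (q (w, t))) = q (w, t) by rewrite reprK.
move: kE wE; case: (repr _) => w' t' /= kE <-.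
have -> : t' = t + k%:~R by rewrite -kE addrC subrK.
by rewrite -homeo_iterD floorDrz ?intr_int// intrKfloor.
Qed.

Lemma suspension_base_repr (x : suspension T) :
  exists2 t, 0 <= t < 1 & x = q (suspension_base x, t).
Proof.
have xE : x = q (repr x) by rewrite reprK.
move: xE; rewrite /suspension_base; case: (repr x) => w t -> /=.
have /andP[t0 t1] := floor_itv t; rewrite rmorphD/= in t1.
exists (t - (Num.floor t)%:~R); last by rewrite suspension_pi_shift.
by apply/andP; split; lra.
Qed.

Lemma open_setX (V : set Omega) (a b : R) : open V -> open (V `*` `]a, b[%classic).
Proof.
move=> oV; rewrite openE => -[w t] [/= Vw tab].
exists (V, `]a, b[%classic); last by [].
split; first exact: open_nbhs_nbhs.
by apply: open_nbhs_nbhs; split => //; exact: interval_open.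
Qed.

(** The base point may jump at the cross section, so times in [(0, 1)], which give an open set, are
    separated from time [0], which gives a difference of open sets. *)
Lemma suspension_base_measurable : measurable_fun
  [set: borel (suspension T)] (suspension_base : borel (suspension T) -> borel Omega).
Proof.
apply: (@measurability _ _ (borel (suspension T)) (borel Omega) setT _ (@open Omega) erefl).
move=> _ [V oV <-]; rewrite setTI.
have -> : suspension_base @^-1` V =
    [set q p | p in V `*` `]0, 1[%classic] `|`
    ([set q p | p in V `*` `](-1), 1[%classic] `\` [set q p | p in setT `*` `]0, 1[%classic]).
  apply/seteqP; split => x /=.
    have [t /andP[t0 t1] xE] := suspension_base_repr x => Vx.
    move: t0; rewrite le_eqVlt => /orP[/eqP t0|t0].
      right; split; first by exists (suspension_base x, t) => //=; split => //=; rewrite in_itv/= t1 -t0 ltrN10.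
      move=> [[w s] [_ /=]]; rewrite in_itv/= => /andP[s0 s1] /esym.
      rewrite xE -t0 => /suspension_piE[k /= kE _].
      have k1 : k%:~R < (0 : int)%:~R :> R by lra.
      have k2 : (-1 : int)%:~R < k%:~R :> R by rewrite rmorphN1; lra.
      by move: k1 k2; rewrite !ltr_int; lia.
    by left; exists (suspension_base x, t) => //=; split => //=; rewrite in_itv/= t0.
  case=> [[[w t] [/= Vw]]|[[[w t] [/= Vw]]]]; rewrite in_itv/= => /andP[t0 t1].
    by move=> <-; rewrite suspension_base_pi (_ : Num.floor t = 0)//; apply: floor_def; rewrite (ltW t0).
  move=> <- nx; rewrite suspension_base_pi.
  have [t00|t00] := eqVneq t 0; first by rewrite t00 floor0.
  exfalso; apply: nx; move: t00; rewrite neq_lt => /orP[tn|tp].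
    exists (homeo_iter T (-1) w, t - (-1)%:~R); last exact: suspension_pi_shift.
    by split => //=; rewrite in_itv/= rmorphN1; apply/andP; split; lra.
  by exists (w, t) => //; split => //=; rewrite in_itv/= tp.
apply: measurableU.
  by apply: open_borel; apply: suspension_pi_open; exact: open_setX.
apply: measurableD.
  by apply: open_borel; apply: suspension_pi_open; exact: open_setX.
by apply: open_borel; apply: suspension_pi_open; apply: open_setX; exact: openT.
Qed.

End suspension_topology.

(** * Null sets of the suspension measure *)

Section suspension_measure.
Variables (R : realType) (Omega : pmetricType R) (T : homeo Omega).
Hypothesis Omega_compact : compact [set: Omega].
Variable mu : probability (borel Omega) R.
Local Notation q := (\pi_(suspension T)).

Lemma nat_basis : exists2 B : nat -> set Omega, forall n, open (B n) &
  forall w U, nbhs w U -> exists2 n, B n w & B n `<=` U.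
Proof.
have [BB /countable_injP[f finj] [BBo BBb]] := compact_second_countable Omega_compact.
(* Indices that number no basis element get the empty set, so that every [B n] is open. *)
pose B n := xget set0 [set U | BB U /\ f U = n].
have BE U : BB U -> B (f U) = U.
  move=> BU; rewrite /B; case: xgetP => [V _ [BV fV]|/(_ U)[]//].
  by apply: finj => //; rewrite in_setE.
exists B => [n|w U wU].
  rewrite /B; case: xgetP => [V _ [/BBo]//|_]; exact: open0.
have [V [BV Vw] VU] := BBb w _ wU.
by exists (f V); rewrite BE.
Qed.

(** With a countable basis of [Omega], an open set is a countable union of open rectangles: each
    basis element is paired with the interior of the times at which all of it lies in [O]. *)
Lemma open_prod_measurable (O : set (Omega * R)) : open O ->
  measurable (O : set (borel Omega * R)).
Proof.
move=> oO; have [B Bo Bb] := nat_basis.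
have -> : O = \bigcup_n (B n `*` [set t | forall w, B n w -> O (w, t)]^°).
  apply/seteqP; split => [[w t] Owt|[w t] [n _ [/= Bw /interior_subset]]]; last exact.
  have [[U V] /= [Uw Vt] UV] : nbhs (w, t) O by apply: open_nbhs_nbhs.
  have [n Bnw BnU] := Bb w U Uw.
  exists n => //; split => //=; apply: filterS Vt => s Vs v Bv.
  by apply: (UV (v, s)); split => //; exact: BnU.
apply: bigcupT_measurable => n; apply: measurableX; first exact: open_borel.
by apply: open_measurable; exact: open_interior.
Qed.

Lemma suspension_pi_measurable : measurable_fun [set: borel Omega * R]
  (q : borel Omega * R -> borel (suspension T)).
Proof.
apply: (@measurability _ _ _ (borel (suspension T)) setT _ (@open (suspension T)) erefl).
move=> _ [U oU <-]; rewrite setTI; apply: open_prod_measurable.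
exact: oU.
Qed.

Let cut (A : set (borel (suspension T))) : set (borel Omega * R) :=
  (q @^-1` A) `&` (setT `*` `[0, 1]%classic).

Let measurable_cut A : measurable A -> measurable (cut A).
Proof.
move=> mA; apply: measurableI; last exact: measurableX.
by rewrite -[X in measurable X]setTI; exact: suspension_pi_measurable.
Qed.

(** The definition yields just a set function; comparison with the product measure makes unions of
    null sets null. *)
Lemma suspension_measureE (A : set (borel (suspension T))) : measurable A ->
  suspension_measure mu A = (mu \x @lebesgue_measure R)%E (cut A).
Proof.
move=> mA; rewrite /suspension_measure /product_measure1; apply: eq_integral => w _ /=.
pose S : set (borel Omega * R) := q @^-1` A.
have mS : measurable S.
  by rewrite -[X in measurable X]setTI; exact: suspension_pi_measurable.
have mSw : measurable (xsection S w) by exact: measurable_xsection.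
transitivity (\int[@lebesgue_measure R]_(t in `[0%R, 1%R]) (\1_(xsection S w) t)%:E)%E.
  apply: eq_integral => t _; congr _%:E; rewrite !indicE; congr (_%:R).
  by congr nat_of_bool; apply/idP/idP; rewrite !in_setE /xsection /= in_setE.
rewrite integral_indic//.
congr (lebesgue_measure _); rewrite /cut; apply/seteqP; split => t /=.
  by move=> [/xsectionP qA t01]; apply/xsectionP; split.
by move=> /xsectionP[qA [_ t01]]; split => //; apply/xsectionP.
Qed.

Lemma suspension_negligibleU (A B : set (suspension T)) :
  negligible (suspension_measure mu) A -> negligible (suspension_measure mu) B ->
  negligible (suspension_measure mu) (A `|` B).
Proof.
move=> [A' [mA A0 AA']] [B' [mB B0 BB']]; exists (A' `|` B'); split.
- exact: measurableU.
- rewrite suspension_measureE; last exact: measurableU.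
  rewrite suspension_measureE// in A0; rewrite suspension_measureE// in B0.
  have -> : cut (A' `|` B') = cut A' `|` cut B' by rewrite /cut preimage_setU setIUl.
  transitivity ((mu \x @lebesgue_measure R)%E (cut A')); last exact: A0.
  by apply: measureU0; [exact: measurable_cut|exact: measurable_cut|exact: B0].
- by apply: setUSS.
Qed.

Lemma suspension_aeI (P Q : suspension T -> Prop) :
  {ae suspension_measure mu, forall x, P x} -> {ae suspension_measure mu, forall x, Q x} ->
  {ae suspension_measure mu, forall x, P x /\ Q x}.
Proof.
move=> aP aQ; have [A [mA A0 PQA]] := suspension_negligibleU aP aQ.
exists A; split => // x /= /not_andP[nP|nQ]; apply: PQA; [left|right]; exact.
Qed.

Lemma suspension_ae_ex (P : suspension T -> Prop) :
  {ae suspension_measure mu, forall x, P x} -> exists x, P x.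
Proof.
move=> [A [mA A0 PA]]; apply: contrapT => /forallNP nP.
have AT : A = setT by apply/seteqP; split => // x _; apply: PA; exact: nP.
move: A0; rewrite suspension_measureE// AT /cut preimage_setT setTI.
move=> /eqP; apply/negP; rewrite gt_eqF//.
have -> : (mu \x @lebesgue_measure R)%E (setT `*` `[0, 1]%classic) =
    (mu setT * @lebesgue_measure R `[0%R, 1%R]%classic)%E by exact: product_measure1E.
have -> : mu setT = 1%E by exact: probability_setT.
by rewrite lebesgue_measure_itv /= lte_fin ltr01 mul1e sube0 lte_fin.
Qed.

(* The base point map collapses the suspension onto its cross section, and the
   half-open fundamental domain misses only the null time [t = 1]. *)
Lemma suspension_ae_base (P : Omega -> Prop) : {ae mu, forall w, P w} ->
  {ae suspension_measure mu, forall x : suspension T, P (suspension_base x)}.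
Proof.
move=> [B [mB B0 PB]]; pose A : set (borel (suspension T)) := @suspension_base _ _ T @^-1` B.
have mA : measurable A.
  by have := @suspension_base_measurable _ _ T measurableT B mB; rewrite setTI.
exists A; split => //.
- rewrite /suspension_measure.
  transitivity (\int[mu]_w (\1_B w)%:E)%E.
    apply: eq_integral => w _ /=.
    transitivity (\int[@lebesgue_measure R]_(t in `[0%R, 1%R[) (\1_B w)%:E)%E.
      rewrite -integral_itv_bndo_bndc//; last first.
        apply: measurable_funTS; apply/measurable_EFinP.
        pose S : set (borel Omega * R) := q @^-1` A.
        have mS : measurable S.
          by rewrite -[X in measurable X]setTI; exact: suspension_pi_measurable.
        rewrite (_ : (fun t => _) = \1_(xsection S w)).
          by apply: measurable_indic; exact: measurable_xsection.
        apply/funext => t; rewrite !indicE; congr (nat_of_bool _)%:R.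
        by apply/idP/idP; rewrite !in_setE /xsection /= in_setE.
      apply: eq_integral => t; rewrite in_setE/= in_itv/= => t01; congr _%:E.
      have AE : A (q (w, t)) = B w.
        by rewrite /A /preimage /= suspension_base_pi (_ : Num.floor t = 0)//; exact: floor_def.
      by rewrite !indicE; congr (nat_of_bool _)%:R; apply/idP/idP; rewrite !in_setE AE.
    transitivity ((\1_B w)%:E * @lebesgue_measure R `[0%R, 1%R[%classic)%E.
      exact: integral_cst.
    by rewrite lebesgue_measure_itv /= lte_fin ltr01 sube0 mule1.
  rewrite integral_indic// setIT; exact: B0.
- by move=> x /= nP; apply: PB.
Qed.

End suspension_measure.

Lemma compact_finite_cover (X : topologicalType) (C : eqType) (K : set X)
    (good : C -> Prop) (box : C -> set X) : compact K ->
  (forall x, K x -> exists2 c, good c & nbhs x (box c)) ->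
  exists2 L : seq C, forall c, c \in L -> good c &
    forall x, K x -> exists2 c, c \in L & box c x.
Proof.
move=> /compact_near_coveringP cK Kbox.
(* Near covering is used along finite lists ordered by inclusion: some good list has only covering
   extensions, itself included. *)
pose F := filter_from [set L : seq C | forall c, c \in L -> good c]
  (fun L => [set L' : seq C | {subset L <= L'}]).
have FF : Filter F.
  apply: filter_from_filter; first by exists [::].
  move=> L1 L2 g1 g2; exists (L1 ++ L2).
    by move=> c; rewrite mem_cat => /orP[/g1|/g2].
  by move=> L sL; split=> c cL; apply: sL; rewrite mem_cat cL ?orbT.
have [x Kx|L gL KL] := cK _ F (fun L x => exists2 c, c \in L & box c x) FF.
  have [c gc xc] := Kbox x Kx.
  exists (box c, [set L : seq C | c \in L]); last by move=> [y L] [/= yc cL]; exists c.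
  split => //; exists [:: c]; first by move=> c'; rewrite in_cons orbF => /eqP ->.
  by move=> L; apply; rewrite in_cons eqxx.
by exists L => //; apply: KL.
Qed.

(** * Rotation numbers form a countable group *)

Section schwartzman_group.
Variables (R : realType) (Omega : pmetricType R) (T : homeo Omega).
Hypothesis Omega_compact : compact [set: Omega].
Variable mu : probability (borel Omega) R.
Local Notation qX := (\pi_(suspension T)).
Local Notation q := (\pi_(circle R)).

Lemma schwartzmanB r s : schwartzman T mu r -> schwartzman T mu s ->
  schwartzman T mu (r - s).
Proof.
move=> [f cf fr] [h ch hs]; exists (fun x => circle_sub (f x) (h x)).
  exact: circle_sub_continuous.
have [A [mA A0 AP]] := suspension_aeI Omega_compact fr hs.
exists A; split => // x /= nx; apply: AP => -[[p [cp lp] pr] [p' [cp' lp'] ps]].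
apply: nx; exists (fun t => p t - p' t).
  split; first by move=> t; apply: cvgB; [exact: cp|exact: cp'].
  by move=> t; rewrite -circle_sub_pi lp lp'.
have -> : (fun t => (p t - p' t) / t) = (fun t => p t / t - p' t / t).
  by apply/funext => t; rewrite mulrBl.
exact: cvgB.
Qed.

(** The difference of two lifts always stays within [1 / 4] of an integer. By continuity this
    integer is constant in time, so the difference is bounded and the growth rates agree. *)
Lemma close_lifts_rot (f h : suspension T -> circle R) r s :
  (forall x, exists a b, [/\ f x = q a, h x = q b & `|a - b| < 1 / 4]) ->
  is_rot mu f r -> is_rot mu h s -> r = s.
Proof.
move=> fh fr hs.
have [x [[p [cp lp] pr] [p' [cp' lp'] ps]]] := suspension_ae_ex Omega_compact (suspension_aeI Omega_compact fr hs).
pose d t := p t - p' t.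
have cd : continuous d by move=> t; apply: cvgB; [exact: cp|exact: cp'].
have dint t : exists k : int, `|d t - k%:~R| < 1 / 4.
  have [a [b [fa hb ab]]] := fh (suspension_flow t x).
  have /circle_piE[j jE] : q (p t) = q a by rewrite lp.
  have /circle_piE[k kE] : q (p' t) = q b by rewrite lp'.
  exists (j - k); rewrite /d jE kE rmorphB/=.
  by rewrite (_ : _ - _ = a - b)//; ring.
have [k0 k0E] := dint 0.
have dbound t : 0 <= t -> `|d t - k0%:~R| < 1 / 2.
  move=> t0; rewrite ltNge; apply/negP => ge.
  have cn : continuous (fun t => `|d t - k0%:~R|).
    by move=> u; apply: cvg_norm; apply: cvgB; [exact: cd|exact: cvg_cst].
  (* Drifting away from [k0] would mean passing a time at distance exactly [1 / 2] from it, too far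
     from every integer. *)
  have [|u _ uE] := IVT t0 (continuous_subspaceT cn) (v := 1 / 2).
    by rewrite ge_min le_max ge orbT andbT; apply/orP; left; lra.
  have [k] := dint u; rewrite ltr_norml => /andP[k1 k2].
  have ints (m : int) : m%:~R <= (-1 : R) \/ m%:~R = (0 : R) \/ (1 : R) <= m%:~R.
    have [m1|m1] := leP m (-1); first by left; rewrite -[-1](rmorphN1 intr) ler_int.
    have [m2|m2] := leP 1 m; first by right; right; rewrite -[1](rmorph1 intr) ler_int.
    by right; left; rewrite (_ : m = 0)//; lia.
  have := ints (k - k0); rewrite rmorphB/= => km.
  have [e|e] : d u - k0%:~R = 1 / 2 \/ d u - k0%:~R = - (1 / 2).
    by move: uE => /eqP; rewrite eqr_norml => /andP[/orP[/eqP|/eqP]]; [left|right].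
  - by case: km => [km|[km|km]]; lra.
  - by case: km => [km|[km|km]]; lra.
pose C := `|k0%:~R : R| + 1.
have dC t : 0 <= t -> `|d t| <= C.
  move=> /dbound dt; rewrite -[d t](subrK k0%:~R) (le_trans (ler_normD _ _))// addrC lerD2l.
  by rewrite (le_trans (ltW dt))//; lra.
have cvgd : d t / t @[t --> +oo] --> r - s.
  have -> : (fun t => d t / t) = (fun t => p t / t - p' t / t).
    by apply/funext => t; rewrite mulrBl.
  exact: cvgB.
apply/eqP; rewrite -subr_eq0 -normr_le0; apply/ler_addgt0Pl => e e0; rewrite addr0.
have e20 : 0 < e / 2 by rewrite divr_gt0.
have /cvgrPdist_lt/(_ _ e20)[M [_ HM]] := cvgd.
pose t := Num.max 1 (Num.max (M + 1) (C / (e / 2))).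
have t1 : 1 <= t by rewrite le_max lexx.
have tM : M < t by rewrite (@lt_le_trans _ _ (M + 1)) ?ltrDl// !le_max lexx !orbT.
have tC : C / (e / 2) <= t by rewrite !le_max lexx !orbT.
have t0 : 0 < t by rewrite (lt_le_trans _ t1).
have h1 := HM t tM.
have h2 : `|d t / t| <= e / 2.
  rewrite normrM normfV (gtr0_norm t0) ler_pdivrMr// mulrC.
  by rewrite -ler_pdivrMr// (le_trans _ tC)// ler_pM2r ?invr_gt0// dC// ltW.
rewrite -[r - s](subrK (d t / t)) (le_trans (ler_normD _ _))//.
by rewrite [e]splitr lerD// ltW.
Qed.

(* An index of an open set of a countable basis of [Omega], the rational end
   points of a time interval, and a rational approximate value. *)
Definition rect_code : countType := (nat * (rat * (rat * rat)))%type.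

(** Finitely many codes cover one period. Two maps fitting the same codes differ by less than
    [1 / 8 + 1 / 8], so by [close_lifts_rot] a finite list of codes determines the rotation
    number. *)
Lemma schwartzman_countable : countable (schwartzman T mu).
Proof.
have [B Bo Bb] := nat_basis Omega_compact.
pose box (l : rect_code) : set (Omega * R) := B l.1 `*` `]ratr l.2.1, ratr l.2.2.1[%classic.
pose fits (f : suspension T -> circle R) (l : rect_code) := forall p, box l p ->
  exists2 a, f (qX p) = q a & `|a - ratr l.2.2.2| < 1 / 8.
pose codes f (L : seq rect_code) := (forall l, l \in L -> fits f l) /\
  (forall w t, 0 <= t <= 1 -> exists2 l, l \in L & box l (w, t)).
have box_open l : open (box l) by apply: open_setX; exact: Bo.
have cpt : compact ([set: Omega] `*` `[0, 1]%classic : set (Omega * R)).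
  by apply: compact_setX => //; exact: segment_compact.
have code_ex f : continuous f -> exists L, codes f L.
  move=> cf.
  have [[w t] _|L gL coverL] := compact_finite_cover (good := fits f) (box := box) cpt; last first.
    by exists L; split => // w t t01; apply: coverL; split => //=; rewrite in_itv.
  have [a aE] := circle_pi_surj (f (qX (w, t))).
  have [c /andP[ac ca]] : exists c : rat, a - 1 / 8 < ratr c < a + 1 / 8.
    have lt : a - 1 / 8 < a + 1 / 8 by lra.
    by have [c] := rat_in_itvoo lt; rewrite in_itv/=; exists c.
  have nJ : nbhs (f (qX (w, t))) [set q b | b in ball (ratr c : R) (1 / 8)].
    rewrite -aE; apply: open_nbhs_nbhs; split; first by apply/circle_pi_open/ball_open; lra.
    by exists a => //; rewrite /ball/= ltr_norml; apply/andP; split; lra.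
  have cfq : continuous (fun p => f (qX p)).
    by move=> p; apply: (continuous_at_comp cf); exact: pi_continuous.
  have [[U V] /= [Uw Vt] UV] := cfq (w, t) _ nJ.
  have [n Bnw BnU] := Bb w U Uw.
  move: Vt => /nbhs_ballP[e /= e0 eV].
  have lt1 : t - e < t by lra.
  have lt2 : t < t + e by lra.
  have [x] := rat_in_itvoo lt1; rewrite in_itv/= => /andP[x1 x2].
  have [y] := rat_in_itvoo lt2; rewrite in_itv/= => /andP[y1 y2].
  exists (n, (x, (y, c))).
    move=> [v s] [/= Bv]; rewrite in_itv/= => /andP[xs sy].
    have [|b cb bE] := UV (v, s).
      split; first exact: BnU.
      by apply: eV; rewrite /ball/= ltr_norml; apply/andP; split; lra.
    by exists b => //; rewrite distrC.
  apply: open_nbhs_nbhs; split; first exact: box_open.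
  by split => //=; rewrite in_itv/= x2.
pose code r := xget [::] [set L | exists f, [/\ continuous f, is_rot mu f r & codes f L]].
have codeP r : schwartzman T mu r ->
    exists f, [/\ continuous f, is_rot mu f r & codes f (code r)].
  move=> [f cf fr]; have [L fL] := code_ex f cf.
  by rewrite /code; case: xgetP => [L' -> //|/(_ L)[]]; exists f.
apply/countable_injP; exists (fun r => choice.pickle (code r)) => r s.
rewrite !in_setE => /codeP[f [cf fr [ff fc]]] /codeP[h [ch hs [hf hc]]].
move=> /(pcan_inj choice.pickleK) rs.
apply: close_lifts_rot fr hs => x.
have [t /andP[t0 t1] ->] := suspension_base_repr x.
have [|l lL lb] := fc (suspension_base x) t; first by rewrite t0 ltW.
have [a aE ac] := ff l lL _ lb.
have [|b bE bc] := hf l _ _ lb; first by rewrite -rs.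
exists a, b; split => //.
rewrite -[a](subrK (ratr l.2.2.2)) -addrA (le_lt_trans (ler_normD _ _))//.
by rewrite [X in _ + X]distrC; lra.
Qed.

End schwartzman_group.

(** * From a continuous cocycle to a map on the suspension *)

Section cocycle.
Variables (R : realType) (Omega : pmetricType R) (T : homeo Omega).
Variable c : Omega -> R.
Hypothesis c_cont : continuous c.
Implicit Types (w : Omega) (t : R) (k : int).

(** The truncation of [t] to [[0, 1]]; absolute values make its continuity immediate. *)
Definition ramp t : R := (1 + `|t| - `|t - 1|) / 2.

Lemma ramp0 t : t <= 0 -> ramp t = 0.
Proof. by move=> t0; rewrite /ramp ler0_norm// ler0_norm; lra. Qed.

Lemma ramp1 t : 1 <= t -> ramp t = 1.
Proof. by move=> t1; rewrite /ramp ger0_norm ?(ger0_norm (x := t - 1)); lra. Qed.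

Lemma rampE t : 0 <= t <= 1 -> ramp t = t.
Proof.
by move=> /andP[t0 t1]; rewrite /ramp ger0_norm// ler0_norm; lra.
Qed.

Lemma ramp_continuous : continuous ramp.
Proof.
move=> t; apply: cvgM; last exact: cvg_cst.
apply: cvgB.
  by apply: cvgD; [exact: cvg_cst|apply: cvg_norm; exact: cvg_id].
by apply: cvg_norm; apply: cvgB; [exact: cvg_id|exact: cvg_cst].
Qed.

(* The contribution of the site [k] to the integral of [c] along the suspension
   flow from time [0] to time [t], counted negatively when [t < 0]. *)
Definition flow_term k w t : R :=
  c (homeo_iter T k w) * (ramp (t - k%:~R) - (k < 0)%R%:R).

Definition flow_sum M w t : R :=
  \sum_(i < M) (flow_term (Posz i) w t + flow_term (Negz i) w t).

Definition flow_integral w t : R := flow_sum (Num.bound `|t|) w t.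

Lemma flow_term_pos M w t : t <= M%:R -> flow_term (Posz M) w t = 0.
Proof. by move=> tM; rewrite /flow_term /= ramp0 ?subr0 ?mulr0// subr_le0. Qed.

Lemma flow_term_neg M w t : - M%:R <= t -> flow_term (Negz M) w t = 0.
Proof.
move=> tM; rewrite /flow_term /= ramp1 ?subrr ?mulr0//.
by rewrite (_ : (Negz M)%:~R = - M.+1%:R :> R)// opprK -natr1; lra.
Qed.

(** Sites beyond [|t|] contribute nothing, so any larger cutoff agrees; near a given time one cutoff
    serves, which gives continuity. *)
Lemma flow_integralE M w t : `|t| <= M%:R -> flow_integral w t = flow_sum M w t.
Proof.
suff H K L : `|t| <= K%:R -> (K <= L)%N -> flow_sum L w t = flow_sum K w t.
  move=> tM; have tb : `|t| <= (Num.bound `|t|)%:R by rewrite ltW// archi_boundP.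
  by case/orP: (leq_total M (Num.bound `|t|)) => le; [exact: H|apply/esym/H].
move=> tK /subnK <-; elim: (L - K)%N => // n IH.
rewrite addSn /flow_sum big_ord_recr /= -/(flow_sum _ _ _) IH.
have : `|t| <= (n + K)%:R by rewrite (le_trans tK)// ler_nat leq_addl.
rewrite ler_norml => /andP[t1 t2].
by rewrite flow_term_pos// flow_term_neg// !addr0.
Qed.

Lemma flow_integral_continuous :
  continuous (fun p : Omega * R => flow_integral p.1 p.2).
Proof.
have ct k : continuous (fun p : Omega * R => flow_term k p.1 p.2).
  move=> p.
  have c1 : {for p, continuous (fun p : Omega * R => homeo_iter T k p.1)}.
    by apply: (continuous_at_comp (@homeo_iter_continuous _ _ T k)); exact: cvg_fst.
  have c2 : {for p, continuous (fun p : Omega * R => p.2 - k%:~R)}.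
    by apply: cvgB; [exact: cvg_snd|exact: cvg_cst].
  apply: cvgM; first exact: (continuous_at_comp c_cont c1).
  by apply: cvgB; [exact: (continuous_at_comp ramp_continuous c2)|exact: cvg_cst].
have cs M : continuous (fun p : Omega * R => flow_sum M p.1 p.2).
  elim: M => [|M IH] p.
    rewrite (_ : (fun p => _) = (fun=> 0)); first exact: cvg_cst.
    by apply/funext => x; rewrite /flow_sum big_ord0.
  rewrite (_ : (fun p => _) = (fun p => flow_sum M p.1 p.2 +
    (flow_term (Posz M) p.1 p.2 + flow_term (Negz M) p.1 p.2))).
    by apply: cvgD; [exact: IH|apply: cvgD; exact: ct].
  by apply/funext => x; rewrite /flow_sum big_ord_recr.
move=> [w t]; pose M := (Num.bound `|t|).+1.
have tM : `|t| < M%:R.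
  by rewrite (lt_le_trans (archi_boundP _))// ler_nat.
have near_eq : \forall p \near (w, t), flow_sum M p.1 p.2 = flow_integral p.1 p.2.
  have cn : {for (w, t), continuous (fun p : Omega * R => `|p.2|)}.
    by apply: cvg_norm; exact: cvg_snd.
  have : \forall p \near (w, t), `|p.2| < M%:R by exact: (cvgr_lt _ cn).
  by apply: filterS => p pM; rewrite (flow_integralE _ (ltW pM)).
rewrite /continuous_at /= (flow_integralE w (ltW tM)).
by apply: cvg_trans (cs M (w, t)); apply: near_eq_cvg.
Qed.

Lemma flow_term_shift k w t : flow_term k (T w) (t - 1) =
  flow_term (k + 1) w t - (k == -1)%:R * c w.
Proof.
rewrite /flow_term -[T w]/(homeo_iter T 1 w) -homeo_iterD rmorphD/=.
have -> : t - 1 - k%:~R = t - (k%:~R + 1) by ring.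
have [->|k1] := eqVneq k (-1); first by rewrite /= addNr; ring.
have -> : (k < 0)%R = (k + 1 < 0)%R by lia.
by rewrite mul0r subr0.
Qed.

(** Starting one unit later loses the first site, which contributes [c w]. After reindexing, the
    sums telescope up to two boundary terms beyond the cutoff, which vanish. *)
Lemma flow_integral_shift w t : flow_integral (T w) (t - 1) = flow_integral w t - c w.
Proof.
pose m := Num.bound `|t|.
have tm : `|t| <= m%:R by rewrite ltW// archi_boundP.
have tM : `|t| <= m.+1%:R by rewrite (le_trans tm)// ler_nat.
have tM' : `|t - 1| <= m.+1%:R.
  by rewrite (le_trans (ler_normB _ _))// normr1 -natr1 lerD2r.
rewrite (flow_integralE _ tM) (flow_integralE _ tM') /flow_sum.
under eq_bigr do rewrite !flow_term_shift.
set E := fun k => flow_term k w t.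
have -> : \sum_(i < m.+1) (flow_term (Posz i + 1) w t - (Posz i == -1)%:R * c w +
    (flow_term (Negz i + 1) w t - (Negz i == -1)%:R * c w)) =
    \sum_(i < m.+1) (E (Posz i + 1) + E (Negz i + 1)) - c w.
  transitivity (\sum_(i < m.+1) (E (Posz i + 1) + E (Negz i + 1)) -
      \sum_(i < m.+1) ((Posz i == -1)%:R * c w + (Negz i == -1)%:R * c w)).
    by rewrite -sumrB; apply: eq_bigr => i _; rewrite /E; ring.
  congr (_ - _); rewrite big_ord_recl big1 => [|i _]; last by rewrite /= !mul0r addr0.
  by rewrite /= mul0r add0r mul1r addr0.
congr (_ - _).
have telescope n : \sum_(i < n.+1) (E (Posz i + 1) + E (Negz i + 1)) =
    \sum_(i < n.+1) (E (Posz i) + E (Negz i)) + E (Posz n.+1) - E (Negz n).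
  elim: n => [|n IH]; first by rewrite !big_ord1 /=; ring.
  rewrite big_ord_recr IH [in RHS]big_ord_recr /=.
  have -> : Posz n.+1 + 1 = Posz n.+2 by lia.
  have -> : Negz n.+1 + 1 = Negz n by lia.
  by ring.
move: tm tM; rewrite !ler_norml => /andP[t1 _] /andP[_ t2].
have Ep : E (Posz m.+1) = 0 by exact: flow_term_pos.
have En : E (Negz m) = 0 by exact: flow_term_neg.
by rewrite telescope Ep En addr0 subr0.
Qed.

(** Completed units give the Birkhoff sum; the unfinished one contributes at most [K]. *)
Lemma flow_integral_birkhoff K w t : (forall v, `|c v| <= K) -> 0 <= t ->
  `|flow_integral w t - \sum_(i < Num.truncn t) c (iter i T w)| <= K.
Proof.
move=> cK t0; set n := Num.truncn t.
have /andP[nt tn] := truncn_itv t0; rewrite -/n in nt tn.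
have tM : `|t| <= n.+1%:R by rewrite ger0_norm// ltW.
rewrite (flow_integralE _ tM) /flow_sum big_ord_recr /=.
have neg0 i : flow_term (Negz i) w t = 0.
  by rewrite flow_term_neg// (le_trans _ t0)// oppr_le0.
rewrite neg0 addr0 (eq_bigr (fun i : 'I_n => c (iter i T w))); last first.
  move=> i _; rewrite neg0 addr0 /flow_term /= subr0 ramp1 ?mulr1//.
  by rewrite lerBrDl natr1 (le_trans _ nt)// ler_nat.
rewrite addrAC subrr add0r /flow_term /= subr0 normrM -[leRHS]mulr1.
have tn1 : 0 <= t - n%:R <= 1 by move: tn; rewrite -natr1 => tn; apply/andP; split; lra.
have /andP[r0 r1] := tn1.
by rewrite rampE// ler_pM// ger0_norm.
Qed.

Variable mu : probability (borel Omega) R.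
Hypothesis Omega_compact : compact [set: Omega].
Hypothesis mu_invariant : invariant_measure T mu.
Hypothesis mu_ergodic : ergodic T mu.

Lemma continuous_bounded_mfun : bounded_mfun (c : borel Omega -> R).
Proof.
split; first exact: continuous_borel_real.
have := continuous_compact (continuous_subspaceT c_cont) Omega_compact.
move=> /compact_bounded[C [_ HC]]; exists (C + 1) => w.
by apply: (HC (C + 1)); [rewrite ltrDl|exists w].
Qed.

Lemma ae_birkhoff : {ae mu, forall w, n%:R^-1 * \sum_(i < n) c (iter i T w) @[n --> \oo]
  --> Rintegral mu [set: borel Omega] c}.
Proof.
apply: (@birkhoff _ (borel Omega) R mu T _ mu_invariant mu_ergodic c continuous_bounded_mfun).
exact: continuous_borel (@homeo_continuous _ T).
Qed.

Lemma flow_integral_cvg w t0 (a l : R) :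
  n%:R^-1 * \sum_(i < n) c (iter i T w) @[n --> \oo] --> l ->
  (a + flow_integral w (t0 + t)) / t @[t --> +oo] --> l.
Proof.
move=> cvgS; have [_ [K cK]] := continuous_bounded_mfun.
have K0 : 0 <= K by rewrite (le_trans _ (cK point)).
suff main (e : R) : 0 < e -> \forall t \near +oo, `|l - (a + flow_integral w (t0 + t)) / t| <= e.
  by apply/cvgrPdist_le => e e0; exact: main.
move=> e0.
have e4 : 0 < e / 4 by rewrite divr_gt0.
have /cvgrPdist_le/(_ _ e4)[n0 _ Hn0] := cvgS.
(* The errors that do not grow: the initial value, the unfinished unit, and the replacement of [t]
   by the integer part of [t0 + t]. *)
pose C := `|a| + K + `|l| * (1 + `|t0|).
near=> t.
have tC : C <= e / 2 * t.
  have : C / (e / 2) <= t by near: t; apply: nbhs_pinfty_ge; exact: num_real.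
  by rewrite ler_pdivrMr ?divr_gt0// mulrC.
have tt0 : `|t0| <= t by near: t; apply: nbhs_pinfty_ge; exact: num_real.
have tn0 : n0.+1%:R + `|t0| <= t by near: t; apply: nbhs_pinfty_ge; exact: num_real.
have t1 : 0 < t.
  by apply: lt_le_trans tn0; rewrite ltr_pwDl// ltr0n.
have := tt0; rewrite ler_norml => /andP[t0l t0u].
have st0 : 0 <= t0 + t by lra.
have fb := flow_integral_birkhoff w cK st0.
have /andP[nt tn] := truncn_itv st0.
set n := Num.truncn (t0 + t) in fb nt tn.
have n0n : (n0.+1 <= n)%N.
  have : (n0.+1%:R : R) < n.+1%:R.
    by apply: le_lt_trans tn; have := ler_norm (- t0); rewrite normrN; lra.
  by rewrite ltr_nat.
have nR : 0 < n%:R :> R by rewrite ltr0n (leq_trans _ n0n).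
have Sn := Hn0 n (ltnW n0n).
set S := \sum_(i < n) _ in fb; rewrite -/S in Sn.
have Sn' : `|n%:R * l - S| <= n%:R * (e / 4).
  have -> : n%:R * l - S = n%:R * (l - n%:R^-1 * S) by field; rewrite gt_eqF.
  by rewrite normrM gtr0_norm// ler_pM2l.
have tl : `|l * (t - n%:R)| <= `|l| * (1 + `|t0|).
  rewrite normrM ler_wpM2l// ler_norml; rewrite -natr1 in tn.
  by have := ler_norm t0; have := ler_norm (- t0); rewrite normrN => ? ?; apply/andP; split; lra.
have main : `|l * t - (a + flow_integral w (t0 + t))| <= e * t.
  have -> : l * t - (a + flow_integral w (t0 + t)) = l * (t - n%:R) + (n%:R * l - S) +
    (S - flow_integral w (t0 + t)) - a by ring.
  rewrite (le_trans (ler_normB _ _))// (le_trans (lerD (ler_normD _ _) (lexx _)))//.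
  rewrite (le_trans (lerD (lerD (ler_normD _ _) (lexx _)) (lexx _)))//.
  have fb' : `|S - flow_integral w (t0 + t)| <= K by rewrite distrC.
  have ne : n%:R * (e / 4) <= e / 2 * t.
    have : n%:R <= 2 * t by lra.
    by rewrite -(ler_pM2r e4); lra.
  by move: tC; rewrite /C; lra.
have -> : l - (a + flow_integral w (t0 + t)) / t = (l * t - (a + flow_integral w (t0 + t))) / t.
  by field; rewrite gt_eqF.
by rewrite normrM normfV (gtr0_norm t1) ler_pdivrMr.
Unshelve. all: by end_near. Qed.

Local Notation qX := (\pi_(suspension T)).
Local Notation q := (\pi_(circle R)).

(** Modulo [1], [u w + flow_integral w t] is invariant under [(w, t) -> (T w, t - 1)], so it
    descends to the suspension. Its lifts along orbits grow at the mean of [c] by Birkhoff's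
    theorem. *)
Lemma schwartzman_cocycle (u : Omega -> R) :
  continuous (fun w => q (u w)) ->
  (forall w, exists k : int, u (T w) = u w + c w + k%:~R) ->
  schwartzman T mu (Rintegral mu [set: borel Omega] c).
Proof.
move=> cu uT.
(* A subtraction on the circle is used because continuity is known for [u] modulo [1] alone. *)
pose G (p : Omega * R) := circle_sub (q (u p.1)) (q (- flow_integral p.1 p.2)).
have GE w t : G (w, t) = q (u w + flow_integral w t) by rewrite /G circle_sub_pi opprK.
have cG : continuous G.
  apply: circle_sub_continuous.
    by move=> p; apply: (continuous_at_comp cu); exact: cvg_fst.
  apply: circle_pi_continuous => p; apply: cvgN; exact: flow_integral_continuous.
have G1 w t : G (T w, t - 1) = G (w, t).
  have [k kE] := uT w; rewrite !GE flow_integral_shift kE.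
  by apply/circle_piE; exists k; ring.
have Gk (k : int) w t : G (homeo_iter T k w, t - k%:~R) = G (w, t).
  elim/int_rect: k w t => [|n IH|n IH] w t; first by rewrite subr0.
  - rewrite intS addrC homeo_iterS rmorphD/= opprD addrA.
    by rewrite G1 IH.
  - rewrite intS opprD addrC homeo_iterB rmorphB/= -(G1 (homeo_inv T _)) homeo_invK.
    by rewrite -(IH w t); congr (G (_, _)); rewrite ?rmorphN1; ring.
pose phi (x : suspension T) := G (repr x).
have phiE p : phi (qX p) = G p.
  rewrite /phi; have /suspension_piE[k kE wE] : qX (repr (qX p)) = qX p by rewrite reprK.
  move: kE wE; case: (repr _) => w t; case: p => w' t' /= tE <-.
  by rewrite -(Gk k w t); congr (G (_, _)); lra.
exists phi.
  apply/quotient_continuous; rewrite (_ : phi \o qX = G)//.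
  by apply/funext => p; exact: phiE.
have := suspension_ae_base T Omega_compact ae_birkhoff.
move=> [A [mA A0 AP]]; exists A; split => // x /= nx; apply: AP => cvgx; apply: nx.
have [t0 _ xE] := suspension_base_repr x.
set w := suspension_base x in cvgx xE.
exists (fun t => u w + flow_integral w (t0 + t)); last exact: flow_integral_cvg.
split=> [t|t]; last by rewrite xE suspension_flowE phiE GE.
apply: cvgD; first exact: cvg_cst.
have c1 : {for t, continuous (fun _ : R => w)} by exact: cvg_cst.
have c2 : {for t, continuous (fun t => t0 + t)}.
  by apply: cvgD; [exact: cvg_cst|exact: cvg_id].
have cf : {for t, continuous (fun t => (w, t0 + t))} by exact: cvg_pair c1 c2.
exact: (continuous_at_comp flow_integral_continuous cf).
Qed.

End cocycle.

(** * Gap labelling *)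

Lemma average_bounded_diff (R : realType) (x y : nat -> R) (C l : R) :
  (forall n, `|x n.+1 - y n.+1| <= C) ->
  n%:R^-1 * x n @[n --> \oo] --> l -> n%:R^-1 * y n @[n --> \oo] --> l.
Proof.
move=> xyC xl; have C0 : 0 <= C by exact: le_trans (xyC 0%N).
suff main (e : R) : 0 < e -> \forall n \near \oo, `|l - n%:R^-1 * y n| <= e.
  by apply/cvgrPdist_le => e e0; exact: main.
move=> e0; have e2 : 0 < e / 2 by rewrite divr_gt0.
have /cvgrPdist_le/(_ _ e2)[n0 _ H] := xl.
exists (maxn n0.+1 (Num.bound (C / (e / 2)))) => // n.
rewrite /= geq_max => /andP[n0n nb].
have nR : 0 < n%:R :> R by rewrite ltr0n (leq_trans _ n0n).
have := H n (ltnW n0n); case: n n0n nb nR => // n n0n nb nR h.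
have Cn : C / (e / 2) <= n.+1%:R.
  by rewrite (le_trans (ltW (archi_boundP _)))// ?ler_nat// divr_ge0// ltW.
have -> : l - n.+1%:R^-1 * y n.+1 =
    l - n.+1%:R^-1 * x n.+1 + n.+1%:R^-1 * (x n.+1 - y n.+1) by ring.
rewrite (le_trans (ler_normD _ _))// [e]splitr lerD//.
rewrite normrM gtr0_norm ?invr_gt0// ler_pdivrMl// (le_trans (xyC n))//.
by rewrite -ler_pdivrMr.
Qed.

Section gap_labelling.
Variables (R : realType) (Omega : pmetricType R) (T : homeo Omega) (g : Omega -> R).
Variable mu : probability (borel Omega) R.
Hypothesis Omega_compact : compact [set: Omega].
Hypothesis mu_invariant : invariant_measure T mu.
Hypothesis mu_ergodic : ergodic T mu.
Hypothesis mu_support : measure_support mu = [set: Omega].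
Hypotheses (g_gt0 : forall w, 0 < g w) (g_cont : continuous g).

Let T_cont : continuous (T : Omega -> Omega) := @homeo_continuous _ T.

(** The section may jump by multiples of [pi], which a function periodic in the angle does not
    see. *)
Lemma continuous_mod_pi (Z : topologicalType) (u : Omega -> R) (F : Omega * R -> Z) :
  (forall w e, 0 < e -> \forall v \near w, exists k : int, `|u v - u w - pi * k%:~R| < e) ->
  continuous F -> (forall w x (k : int), F (w, x + pi * k%:~R) = F (w, x)) ->
  continuous (fun w => F (w, u w)).
Proof.
move=> cu cF FP w A nA.
have [[U V] /= [Uw Vx] UV] := cF (w, u w) A nA.
move: Vx => /nbhs_ballP[e /= e0 eV].
change (\forall v \near w, A (F (v, u v))).
move: Uw (cu w e e0); apply: filterS2 => v Uv [k kE].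
rewrite -(FP v (u v) (- k)); apply: (UV (v, _)); split => //=.
apply: eV; rewrite /ball/= distrC; move: kE; congr (`|_| < _).
by rewrite rmorphN/=; ring.
Qed.

(** On the section the orbit advances by [pi] times the Birkhoff sums of [c]; the orbit of [0] stays
    at bounded distance from it, so both have rate the mean of [c]. *)
Lemma gap_rotation th0 : in_spectral_gap T mu g (cis th0) ->
  exists2 l, schwartzman T mu l &
    {ae mu, forall w, n%:R^-1 * (lift_orbit T g th0 n w 0 / pi) @[n --> \oo] --> l}.
Proof.
have p0 := @pi_gt0 R.
move=> /(gap_separation g_gt0 g_cont)[d [d0 dpi sep]].
have [u [uT uc]] := invariant_section g_gt0 g_cont mu_invariant mu_support d0 dpi sep.
pose lift := lift_orbit T g th0.
have lift1_cont : continuous (fun p : Omega * R => lift 1%N p.1 p.2).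
  move=> p; apply: (@lift_orbit_continuous _ _ _ _ g_gt0 _ (fun=> th0) fst snd _ _ g_cont T_cont).
  - exact: cvg_cst.
  - exact: cvg_fst.
  - exact: cvg_snd.
pose c w := (lift 1%N w (u w) - u w) / pi.
have c_cont : continuous c.
  apply: (continuous_mod_pi (F := fun p => (lift 1%N p.1 p.2 - p.2) / pi) uc).
    move=> p; apply: cvgM; last exact: cvg_cst.
    by apply: cvgB; [exact: lift1_cont|exact: cvg_snd].
  by move=> w x k; congr (_ / pi); rewrite /= -[lift 1%N w _]/(lift_orbit T g th0 1 w _) lift_orbitDpi /lift; ring.
have u_cont : continuous (fun w => \pi_(circle R) (u w / pi)).
  apply: (continuous_mod_pi (F := fun p => \pi_(circle R) (p.2 / pi)) uc).
    apply: circle_pi_continuous => p.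
    by apply: cvgM; [exact: cvg_snd|exact: cvg_cst].
  move=> w x k; apply/circle_piE; exists k => /=.
  by rewrite mulrDl [pi * _]mulrC mulfK// lt0r_neq0.
exists (Rintegral mu [set: borel Omega] c).
  apply: (schwartzman_cocycle c_cont Omega_compact mu_invariant mu_ergodic u_cont) => w.
  have [k ->] := uT w; exists k; rewrite /c /lift.
  by move: (pi : R) (lt0r_neq0 p0) => q qn; field.
have := ae_birkhoff c_cont Omega_compact mu_invariant mu_ergodic.
apply: (@filterS _ _ (ae_filter_ringOfSetsType mu)) => w.
have liftu n : exists k : int, lift n w (u w) = u (iter n T w) + pi * k%:~R.
  elim: n => [|n [k IH]]; first by exists 0; rewrite mulr0 addr0.
  have [j jE] := uT (iter n T w); exists (k - j).
  rewrite iterS jE -[n.+1]add1n /lift lift_orbitD -/(lift n w (u w)) IH lift_orbitDpi.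
  by rewrite rmorphB/=; ring.
have liftS n : lift n w (u w) = u w + pi * \sum_(i < n) c (iter i T w).
  elim: n => [|n IH]; first by rewrite big_ord0 mulr0 addr0.
  rewrite big_ord_recr /= mulrDr addrA -IH.
  have [k kE] := liftu n.
  rewrite -[n.+1]add1n /lift lift_orbitD -/(lift n w (u w)) kE lift_orbitDpi.
  by rewrite /c /lift; move: (pi : R) (lt0r_neq0 p0) => q qn; field.
(* [u w] lies within [m] half turns of [0], and by monotonicity so do the two orbits at all
   times. *)
pose m := Num.bound `|u w / pi|.
have um : `|u w| <= pi * m%:R.
  rewrite -ler_pdivrMl// -[pi^-1](gtr0_norm (x := pi^-1)) ?invr_gt0// -normrM mulrC.
  by rewrite ltW// archi_boundP.
apply: (@average_bounded_diff _ _ _ (m%:R + m%:R)) => n.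
have : `|lift n.+1 w 0 - lift n.+1 w (u w)| <= pi * m%:R.
  move: um; rewrite !ler_norml => /andP[u1 u2].
  have h1 : lift n.+1 w (0 + pi * (- m%:Z)%:~R) <= lift n.+1 w (u w).
    by rewrite /lift lift_orbit_mono_le// rmorphN/= mulrN add0r.
  have h2 : lift n.+1 w (u w) <= lift n.+1 w (0 + pi * (m%:Z)%:~R).
    by rewrite /lift lift_orbit_mono_le// add0r.
  move: h1 h2; rewrite /lift !lift_orbitDpi rmorphN/= mulrN => h1 h2.
  move: (lift_orbit _ _ _ _ _ 0) (lift_orbit _ _ _ _ _ (u w)) (pi * _) h1 h2 => p q r h1 h2.
  by apply/andP; split; lra.
rewrite liftS => h.
set S := \sum_(i < n.+1) _ in h *.
have -> : S - lift_orbit T g th0 n.+1 w 0 / pi =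
    (u w + pi * S - lift n.+1 w 0) / pi - u w / pi by rewrite /lift; move: (pi : R) (lt0r_neq0 p0) => q qn; field.
rewrite (le_trans (ler_normB _ _))// !normrM normfV (gtr0_norm p0) lerD//.
  by rewrite ler_pdivrMr// [_ * pi]mulrC distrC.
by rewrite ler_pdivrMr// [_ * pi]mulrC.
Qed.

Lemma gap_labelling (z1 z2 : R[i]) : `|z1| = 1 -> `|z2| = 1 ->
  in_spectral_gap T mu g z1 -> in_spectral_gap T mu g z2 ->
  {ae mu, forall w, exists2 l : R, schwartzman T mu l &
    (N%:R^-1 * (zero_count T g z1 z2 w N)%:R : R) @[N --> \oo] --> l}.
Proof.
move=> z11 z21; have p0 := @pi_gt0 R.
have [a [t [t02 -> ->]]] := circle_arc_endpoints z11 z21.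
move=> /gap_rotation[l1 S1 ae1] /gap_rotation[l2 S2 ae2].
move: ae1 ae2; apply: (@filterS2 _ _ (ae_filter_ringOfSetsType mu)) => w c1 c2.
exists (l2 - l1); first exact: schwartzmanB.
(* The constant [3] adds the counting error [1] and one rounding error below [1] at each end of the
   arc. *)
apply: (@average_bounded_diff _ (fun n => lift_orbit T g (a + t) n w 0 / pi -
  lift_orbit T g a n w 0 / pi) _ 3).
  move=> n; have := zero_count_level T g_gt0 g_cont a w n t02.
  rewrite -(ler_int R) intr_norm rmorphB/= rmorphB/= -pmulrn.
  set Z : R := (zero_count _ _ _ _ _ _)%:R.
  have /andP[] := level_itv T g n.+1 w 0 (a + t); have /andP[] := level_itv T g n.+1 w 0 a.
  set L1 : R := (level _ _ _ _ _ a)%:~R; set L2 : R := (level _ _ _ _ _ (a + t))%:~R.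
  set F1 := lift_orbit _ _ a _ _ _; set F2 := lift_orbit _ _ (a + t) _ _ _.
  rewrite !add0r => a1 a2 b1 b2.
  have a1' : L1 <= F1 / pi by rewrite ler_pdivlMr// mulrC.
  have a2' : F1 / pi < L1 + 1 by rewrite ltr_pdivrMr// mulrDl mul1r mulrC.
  have b1' : L2 <= F2 / pi by rewrite ler_pdivlMr// mulrC.
  have b2' : F2 / pi < L2 + 1 by rewrite ltr_pdivrMr// mulrDl mul1r mulrC.
  rewrite -[X in X / pi - _]/F2 -[X in _ - X / pi - _]/F1.
  move: (F1 / pi) (F2 / pi) a1' a2' b1' b2' => f1 f2 f1l f1g f2l f2g.
  by rewrite !ler_norml => /andP[? ?]; apply/andP; split; lra.
rewrite (_ : (fun n => _) = (fun n => n%:R^-1 * (lift_orbit T g (a + t) n w 0 / pi) -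
  n%:R^-1 * (lift_orbit T g a n w 0 / pi))).
  exact: cvgB.
by apply/funext => n; rewrite mulrBr.
Qed.

End gap_labelling.

Theorem theorem1p1 (R : realType) (Omega : pmetricType R) (T : homeo Omega)
    (mu : probability (borel Omega) R)
    (Omega_compact : compact [set: Omega])
    (mu_invariant : invariant_measure T mu)
    (mu_ergodic : ergodic T mu)
    (mu_support : measure_support mu = [set: Omega]) :
  [/\ countable (schwartzman T mu),
      schwartzman T mu 0,
      (forall r s : R, schwartzman T mu r -> schwartzman T mu s ->
        schwartzman T mu (r - s)) &
      forall (g : Omega -> R), continuous g -> (forall w, 0 < g w) ->
      forall z1 z2 : R[i], `|z1| = 1 -> `|z2| = 1 ->
        in_spectral_gap T mu g z1 -> in_spectral_gap T mu g z2 ->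
        {ae mu, forall w, exists2 l : R, schwartzman T mu l &
          (N%:R^-1 * (zero_count T g z1 z2 w N)%:R : R) @[N --> \oo] --> l}].
Proof.
split.
- exact: schwartzman_countable.
(* [0] is the mean of the zero cocycle, with the zero function as section. *)
- have := @schwartzman_cocycle _ _ T (fun=> 0) (fun=> cvg_cst _) mu Omega_compact
    mu_invariant mu_ergodic (fun=> 0) (fun=> cvg_cst _).
  rewrite Rintegral_probability_cst; apply => w.
  by exists 0; rewrite !addr0.
- by move=> r s; exact: schwartzmanB.
- by move=> g g_cont g_gt0 z1 z2; exact: gap_labelling.
Qed.
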